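(* Let $G$ be a compact Lie group and let $\alpha$ be an action of $G$ on a $C^*$-algebra $\mathcal{A}$. If $\alpha$ is saturated, then $\alpha$ is principal.
   Context: Actions are assumed continuous: $\mathcal{A}\to C(G,\mathcal{A})$, $a\mapsto\alpha(a)=(g\mapsto\alpha_g(a))$ is continuous. The crossed product $\mathcal{A}\times_\alpha G$ is the $C^*$-completion of $C(G,\mathcal{A})$ with the product $(f_1\star_\alpha f_2)(g)=\int_Gf_1(h)\alpha_h(f_2(h^{-1}g))\,dh$, where $dh$ is normalized Haar measure. Let $\mathfrak{Fin}\subset C(G,\mathcal{A})$ be the linear span of the functions $a\alpha(b^* ):g\mapsto a\alpha_g(b^* )$, $a,b\in\mathcal{A}$. The action $\alpha$ is called saturated if $\mathfrak{Fin}$ is dense in $\mathcal{A}\times_\alpha G$, and principal if $\mathfrak{Fin}$ is dense in $C(G,\mathcal{A})$ (with the supremum norm). *)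

(* Defs.v *)
From HB Require Import structures.
From mathcomp Require Import all_boot all_order all_algebra.
From mathcomp Require Import all_classical all_reals all_analysis.
From mathcomp Require Import complex.
Set Implicit Arguments.
Unset Strict Implicit.
Unset Printing Implicit Defensive.
Import Order.TTheory GRing.Theory Num.Theory.
Import numFieldNormedType.Exports.
Local Open Scope classical_set_scope.
Local Open Scope ring_scope.
Local Open Scope complex_scope.

HB.mixin Record isTopologicalGroup G of PointedTopological G & Group G := {
  mulg_continuous : continuous (fun xy : G * G => (xy.1 * xy.2)%g) ;
  invg_continuous : continuous (fun x : G => (x^-1)%g)
}.

(* The base point is only there because the library builds generated
   sigma-algebras over pointed types; it plays no role. *)
#[short(type="topologicalGroupType")]
HB.structure Definition TopologicalGroup :=
  {G of PointedTopological G & Group G & isTopologicalGroup G}.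

Section Smooth.
Variables (R : realType) (V W : normedModType R).

(* For an open set U, being C^k is equivalent to having continuous iterated
   directional derivatives up to order k on U. *)
Fixpoint class_C (k : nat) (U : set V) (f : V -> W) : Prop :=
  (forall x, U x -> {for x, continuous f}) /\
  (if k is k'.+1 then
     forall v, (forall x, U x -> derivable f x v) /\ class_C k' U ('D_v f)
   else True).

Definition smooth_on (U : set V) (f : V -> W) := forall k, class_C k U f.

End Smooth.

Section LieGroup.
Variables (R : realType) (G : topologicalGroupType).

(* A homeomorphism from an open subset of G onto an open subset of R^n, with
   its inverse; both maps are irrelevant outside their domains. *)
Record chart (n : nat) := Chart {
  chart_dom : set G ;
  chart_img : set 'rV[R]_n ;
  chart_map : G -> 'rV[R]_n ;
  chart_inv : 'rV[R]_n -> G ;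
  chart_dom_open : open chart_dom ;
  chart_img_open : open chart_img ;
  chart_mapP : forall x, chart_dom x -> chart_img (chart_map x) ;
  chart_invP : forall u, chart_img u -> chart_dom (chart_inv u) ;
  chart_mapK : forall x, chart_dom x -> chart_inv (chart_map x) = x ;
  chart_invK : forall u, chart_img u -> chart_map (chart_inv u) = u ;
  chart_map_continuous : forall x, chart_dom x -> {for x, continuous chart_map} ;
  chart_inv_continuous : forall u, chart_img u -> {for u, continuous chart_inv}
}.

Definition smooth_atlas n (At : set (chart n)) :=
  (forall x, exists2 c, At c & chart_dom c x) /\
  (forall c d, At c -> At d ->
     smooth_on [set u | chart_img c u /\ chart_dom d (chart_inv c u)]
       (fun u => chart_map d (chart_inv c u))).

Definition smooth_mul n (At : set (chart n)) :=
  forall c d e, At c -> At d -> At e ->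
    smooth_on
      [set uv : 'rV[R]_n * 'rV[R]_n | [/\ chart_img c uv.1, chart_img d uv.2 &
         chart_dom e (chart_inv c uv.1 * chart_inv d uv.2)%g]]
      (fun uv => chart_map e (chart_inv c uv.1 * chart_inv d uv.2)%g).

Definition smooth_inv n (At : set (chart n)) :=
  forall c d, At c -> At d ->
    smooth_on [set u | chart_img c u /\ chart_dom d (chart_inv c u)^-1%g]
      (fun u => chart_map d (chart_inv c u)^-1%g).

Definition lie_group :=
  [/\ hausdorff_space G, @second_countable G &
      exists n (At : set (chart n)),
        [/\ smooth_atlas At, smooth_mul At & smooth_inv At]].

End LieGroup.

(* C*-algebras, not necessarily unital. *)
HB.mixin Record isCStarAlgebra (R : realType) A
    of CompleteNormedModule R[i] A := {
  cmul : A -> A -> A ;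
  star : A -> A ;
  cmulA : associative cmul ;
  cmulDl : left_distributive cmul +%R ;
  cmulDr : right_distributive cmul +%R ;
  cmulZl : forall (c : R[i]) a b, cmul (c *: a) b = c *: cmul a b ;
  cmulZr : forall (c : R[i]) a b, cmul a (c *: b) = c *: cmul a b ;
  starK : involutive star ;
  starD : {morph star : a b / a + b} ;
  starZ : forall (c : R[i]) a, star (c *: a) = conjc c *: star a ;
  starM : forall a b, star (cmul a b) = cmul (star b) (star a) ;
  norm_cmul : forall a b, `|cmul a b| <= `|a| * `|b| ;
  norm_cstar : forall a, `|cmul (star a) a| = `|a| ^+ 2
}.

#[short(type="cstarAlgType")]
HB.structure Definition CStarAlgebra (R : realType) :=
  {A of CompleteNormedModule R[i] A & isCStarAlgebra R A}.

Notation borel G := (g_sigma_algebraType (@open G)).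

Definition normalized_haar (R : realType) (G : topologicalGroupType)
    (mu : probability (borel G) R) :=
  forall (g : G) (E : set (borel G)), measurable E ->
    mu ((fun h : G => (g * h)%g) @^-1` E) = mu E.

Section Bochner.
Variables (R : realType) (G : topologicalGroupType) (A : completeNormedModType R[i]).
Variable mu : probability (borel G) R.

Definition simple_integral (s : {fimfun G >-> A}) : A :=
  \sum_(a \in range s) (fine (mu (s @^-1` [set a])))%:C *: a.

(* Norms of A are elements of R[i] with zero imaginary part, hence the Re. *)
Definition is_bochner_integral (f : G -> A) (x : A) :=
  exists s : nat -> {fimfun G >-> A},
  [/\ forall n a, measurable (s n @^-1` [set a] : set (borel G)),
      (fun n => \int[mu]_h (complex.Re `|f h - s n h|)%:E)%E @ \oo --> 0%E &
      (fun n => simple_integral (s n)) @ \oo --> x].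

(* 0 if f is not integrable. *)
Definition bochner_integral (f : G -> A) : A := xget 0 (is_bochner_integral f).

End Bochner.

Section Action.
Variables (R : realType) (G : topologicalGroupType) (A : cstarAlgType R).

Record continuous_action (alpha : G -> A -> A) : Prop := ContinuousAction {
  action1 : forall a, alpha 1%g a = a ;
  actionM : forall g h a, alpha (g * h)%g a = alpha g (alpha h a) ;
  actionD : forall g a b, alpha g (a + b) = alpha g a + alpha g b ;
  actionZ : forall g (c : R[i]) a, alpha g (c *: a) = c *: alpha g a ;
  action_cmul : forall g a b, alpha g (cmul a b) = cmul (alpha g a) (alpha g b) ;
  action_star : forall g a, alpha g (star a) = star (alpha g a) ;
  action_orbit_continuous : forall a, continuous (alpha^~ a) ;
  action_continuous : continuous (fun a => alpha^~ a : {uniform G -> A})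
}.

Variables (mu : probability (borel G) R) (alpha : G -> A -> A).

Definition convolution (f1 f2 : G -> A) : G -> A := fun g =>
  bochner_integral mu (fun h => cmul (f1 h) (alpha h (f2 (h^-1 * g)%g))).

(* No modular function, as compact groups are unimodular. *)
Definition involution (f : G -> A) : G -> A := fun g =>
  alpha g (star (f g^-1%g)).

(* The *-algebra C(G, A) is handled as the set of continuous functions in
   G -> A; p and iota below are unconstrained outside of it. *)
Record cstar_seminorm (p : (G -> A) -> R[i]) : Prop := CStarSeminorm {
  seminorm_ge0 : forall f, continuous f -> 0 <= p f ;
  seminormD : forall f1 f2, continuous f1 -> continuous f2 ->
    p (fun g => f1 g + f2 g) <= p f1 + p f2 ;
  seminormZ : forall (c : R[i]) f, continuous f ->
    p (fun g => c *: f g) = `|c| * p f ;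
  seminormM : forall f1 f2, continuous f1 -> continuous f2 ->
    p (convolution f1 f2) <= p f1 * p f2 ;
  seminorm_cstar : forall f, continuous f ->
    p (convolution (involution f) f) = p f ^+ 2
}.

(* (B, iota) is the completion of C(G, A) for its largest C*-seminorm: since
   f |-> `|iota f| is itself a C*-seminorm, crossed_max says that it is the
   largest one. This determines (B, iota) up to unique isomorphism. *)
Record crossed_product (B : cstarAlgType R) (iota : (G -> A) -> B) : Prop :=
  CrossedProduct {
  crossedD : forall f1 f2, continuous f1 -> continuous f2 ->
    iota (fun g => f1 g + f2 g) = iota f1 + iota f2 ;
  crossedZ : forall (c : R[i]) f, continuous f ->
    iota (fun g => c *: f g) = c *: iota f ;
  crossedM : forall f1 f2, continuous f1 -> continuous f2 ->
    iota (convolution f1 f2) = cmul (iota f1) (iota f2) ;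
  crossed_star : forall f, continuous f ->
    iota (involution f) = star (iota f) ;
  crossed_dense : dense (iota @` [set f | continuous f]) ;
  crossed_max : forall p, cstar_seminorm p ->
    forall f, continuous f -> p f <= `|iota f|
}.

Definition Fin : set (G -> A) := [set f |
  exists n (c : 'I_n -> R[i]) (a b : 'I_n -> A),
    f = fun g => \sum_(i < n) c i *: cmul (a i) (alpha g (star (b i)))].

Definition saturated (B : cstarAlgType R) (iota : (G -> A) -> B) :=
  dense (iota @` Fin).

Definition principal :=
  [set f : G -> A | continuous f] `<=` closure (Fin : set {uniform G -> A}).

End Action.

(* Main.v *)
(* The linear span Fin is stable under convolution by C(G, A) on both sides, and
   every F in C(G, A) is a uniform limit of functions x * F * y, with x and y
   supported near the identity and taking values in multiples of approximate
   units of A. It remains to see that convolving turns the C*-norm into the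
   supremum norm: |x * f * y|_sup <= K |f| for x and y fixed. This follows from
   the regular representation of C(G, A) on itself with the A-valued inner
   product <x, y> = (x^* * y)(1): its operator norm is a C*-seminorm, hence is
   dominated by the norm of the crossed product, and the Cauchy-Schwarz
   inequality bounds (x * z)(g) by a multiple of |<z, z>|^(1/2). The Cauchy-Schwarz
   inequality rests on the positivity of a^* a (Fukamiya-Kaplansky), proved here
   from the C*-identity by norm estimates in the unitization, without spectra. *)
Require Import Defs.
From HB Require Import structures.
From mathcomp Require Import all_boot all_order all_algebra.
From mathcomp Require Import all_classical all_reals all_analysis.
From mathcomp Require Import complex.
From mathcomp Require Import ring lra measurable_realfun finmap.
Set Implicit Arguments.
Unset Strict Implicit.
Unset Printing Implicit Defensive.
Import Order.TTheory GRing.Theory Num.Theory.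
Import numFieldNormedType.Exports.
Local Open Scope classical_set_scope.
Local Open Scope ring_scope.
Local Open Scope complex_scope.

(** * Real-valued norms on complex normed modules *)

(** The obstacle is that closeness in the crossed product says nothing directly about closeness in
    the supremum norm, which is the stronger of the two. The two convolutions have different tasks.
    If [F - f] is small in the crossed product, the operator norm only controls [(F - f) * y] in the
    Hilbert module norm [norm2], and this is what the right factor [y] is for; the left factor [x]
    then turns a [norm2] bound into a uniform one. The constants force an order of choice: [x] fixes
    the smoothing constant, [y] is chosen with a tolerance depending on it, and [f] in the span
    comes last, with a tolerance depending on [norm2 y]. The inner product is written as an integral
    of [star (twist x h)] times [twist y h], so that Cauchy-Schwarz is that of square-integrable
    [A]-valued functions and left invariance is the only symmetry of the measure that enters.
    Integrals are compared with finite sums over measurable partitions, by a single estimate from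
    which the rest of the integral calculus follows. *)

Section RealNorm.
Variable R : realType.
Implicit Types V : normedModType R[i].

(** Norms of complex modules live in [R[i]], whose order is only partial; the real part gives access
    to infima, square roots and linear arithmetic over [R]. *)
Definition rnorm V (v : V) : R := complex.Re `|v|.

Lemma ge0_complexE (z : R[i]) : 0 <= z -> z = (complex.Re z)%:C.
Proof. by case: z => a b; rewrite lecE /= => /andP[/eqP->]. Qed.

Lemma rnormE V (v : V) : `|v| = (rnorm v)%:C.
Proof. exact: ge0_complexE. Qed.

Lemma rnorm_ge0 V (v : V) : 0 <= rnorm v.
Proof. by have := normr_ge0 v; rewrite rnormE lecR. Qed.
#[local] Hint Extern 0 (is_true (0 <= rnorm _)) => exact: rnorm_ge0 : core.

Lemma rnorm0 V : rnorm (0 : V) = 0.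
Proof. by rewrite /rnorm normr0. Qed.

Lemma rnorm_eq0 V (v : V) : (rnorm v == 0) = (v == 0).
Proof. by rewrite -(normr_eq0 v) rnormE -(inj_eq (@complexI R)). Qed.

Lemma rnorm_gt0 V (v : V) : (0 < rnorm v) = (v != 0).
Proof. by rewrite lt_neqAle rnorm_ge0 eq_sym rnorm_eq0 andbT. Qed.

Lemma rnormN V (v : V) : rnorm (- v) = rnorm v.
Proof. by rewrite /rnorm normrN. Qed.

Lemma rdistC V (v w : V) : rnorm (v - w) = rnorm (w - v).
Proof. by rewrite -rnormN opprB. Qed.

Lemma rnormD V (v w : V) : rnorm (v + w) <= rnorm v + rnorm w.
Proof. by have := ler_normD v w; rewrite !rnormE -rmorphD lecR. Qed.

Lemma rnormB V (v w : V) : rnorm (v - w) <= rnorm v + rnorm w.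
Proof. by rewrite (le_trans (rnormD _ _))// rnormN. Qed.

Lemma rdistD V (u v w : V) : rnorm (v - w) <= rnorm (v - u) + rnorm (u - w).
Proof. by rewrite (le_trans _ (rnormD _ _))// addrA subrK. Qed.

Lemma rnormZ V (c : R[i]) (v : V) : rnorm (c *: v) = rnorm (c : R[i]^o) * rnorm v.
Proof.
apply: (@complexI R); rewrite -rnormE normrZ rmorphM/= -rnormE.
by congr (_ * _); exact: rnormE.
Qed.

Lemma rnorm_complexE (z : R[i]^o) :
  rnorm z = Num.sqrt (complex.Re z ^+ 2 + complex.Im z ^+ 2).
Proof. by case: z. Qed.

Lemma rnorm_real (r : R) : rnorm (r%:C : R[i]^o) = `|r|.
Proof. by rewrite rnorm_complexE /= expr0n /= addr0 sqrtr_sqr. Qed.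

Lemma rnormZr V (r : R) (v : V) : rnorm (r%:C *: v) = `|r| * rnorm v.
Proof. by rewrite rnormZ rnorm_real. Qed.

Lemma rnorm_sum V (I : Type) (s : seq I) (f : I -> V) :
  rnorm (\sum_(i <- s) f i) <= \sum_(i <- s) rnorm (f i).
Proof.
elim/big_rec2: _ => [|i y x _ h]; first by rewrite rnorm0.
by rewrite (le_trans (rnormD _ _))// lerD2l.
Qed.

Lemma rnormM (c d : R[i]) :
  rnorm (c * d : R[i]^o) = rnorm (c : R[i]^o) * rnorm (d : R[i]^o).
Proof. exact: rnormZ c (d : R[i]^o). Qed.

Lemma rnorm_conjc (c : R[i]) : rnorm (conjc c : R[i]^o) = rnorm (c : R[i]^o).
Proof. by case: c => a b; rewrite !rnorm_complexE /= sqrrN. Qed.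

Lemma gt0_complexE (e : R[i]) : 0 < e -> e = (complex.Re e)%:C /\ 0 < complex.Re e.
Proof.
move=> e0; split; first exact/ge0_complexE/ltW.
by move: (e0); rewrite [X in 0 < X](ge0_complexE (ltW e0)) ltcR.
Qed.

Lemma cvg_rnormP V (T : Type) (F : set_system T) (FF : Filter F) (f : T -> V) (l : V) :
  f @ F --> l <-> forall e : R, 0 < e -> \forall x \near F, rnorm (f x - l) < e.
Proof.
split=> [/cvgrPdist_lt fl e e0|fl].
  have := fl e%:C; rewrite ltcR => /(_ e0); apply: filterS => x.
  by rewrite distrC rnormE ltcR.
apply/cvgrPdist_lt => e /gt0_complexE[-> /fl]; apply: filterS => x.
by rewrite distrC rnormE ltcR.
Qed.

End RealNorm.
#[global] Hint Extern 0 (is_true (0 <= rnorm _)) => exact: rnorm_ge0 : core.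

Section ComplexComplete.
Variable R : realType.

Lemma rnorm_Re (z : R[i]^o) : `|complex.Re z| <= rnorm z.
Proof.
case: z => a b; rewrite rnorm_complexE /= -[ `|a|]ger0_norm// -sqrtr_sqr ler_sqrt.
  by rewrite real_normK ?num_real// lerDl sqr_ge0.
by rewrite addr_ge0 ?sqr_ge0.
Qed.

Lemma rnorm_Im (z : R[i]^o) : `|complex.Im z| <= rnorm z.
Proof.
case: z => a b; rewrite rnorm_complexE /= -[ `|b|]ger0_norm// -sqrtr_sqr ler_sqrt.
  by rewrite real_normK ?num_real// lerDr sqr_ge0.
by rewrite addr_ge0 ?sqr_ge0.
Qed.

Lemma rnorm_ReIm (z : R[i]^o) : rnorm z <= `|complex.Re z| + `|complex.Im z|.
Proof.
case: z => a b; rewrite rnorm_complexE /= -[leRHS]ger0_norm ?addr_ge0// -sqrtr_sqr.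
rewrite ler_sqrt ?sqr_ge0// sqrrD !real_normK ?num_real//.
by rewrite lerD2r lerDl mulrn_wge0 ?mulr_ge0.
Qed.

Lemma complex_complete (F : set_system R[i]^o) : ProperFilter F -> cauchy F -> cvg F.
Proof.
move=> FF /cauchy_ballP FC.
have cauchy_part (q : R[i] -> R) : (forall z w, q (z - w) = q z - q w) ->
    (forall z, `|q z| <= rnorm (z : R[i]^o)) -> cvg (q @ F).
  move=> qB qN; apply/cauchy_cvgP/cauchy_ballP => e e0.
  have [|[S T] /= [FS FT] ST] := FC e%:C; first by rewrite ltcR.
  exists (q @` S, q @` T) => /=.
    by split; [apply: filterS FS | apply: filterS FT] => z Sz; exists z.
  move=> [_ _] /= [[z Sz <-] [w Tw <-]]; rewrite /ball /= -qB.
  have /= := ST (z, w) (conj Sz Tw); rewrite /ball /= => zw.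
  by rewrite (le_lt_trans (qN _))// -ltcR -rnormE.
have /cvg_ex[a Fa] : cvg (@complex.Re R @ F).
  by apply: cauchy_part => [[? ?] [? ?]//|]; exact: rnorm_Re.
have /cvg_ex[b Fb] : cvg (@complex.Im R @ F).
  by apply: cauchy_part => [[? ?] [? ?]//|]; exact: rnorm_Im.
apply/cvg_ex; exists (a +i* b); apply/cvg_rnormP => e e0.
have e20 : 0 < e / 2 by rewrite divr_gt0.
move/cvgrPdist_lt : Fa => /(_ _ e20) Fa; move/cvgrPdist_lt : Fb => /(_ _ e20) Fb.
apply: filterS2 Fa Fb => -[x y] /= xa yb.
rewrite (le_lt_trans (rnorm_ReIm _))//= [ltRHS](splitr e).
by rewrite ltrD// distrC.
Qed.

End ComplexComplete.

(* A copy of R[i]^o: the canonical complete structure on regular modules is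
   taken by that of R^o. *)
Definition scalars (R : realType) : Type := R[i]^o.
HB.instance Definition _ (R : realType) :=
  NormedModule.copy (scalars R) R[i]^o.
HB.instance Definition _ (R : realType) :=
  Uniform_isComplete.Build (scalars R) (@complex_complete R).

(** * The unitization *)

(** The increments telescope to [rnorm (u m - u n) <= t m - t n], and [t] is nondecreasing and
    bounded, hence Cauchy. This majorant form suits the square root iteration. *)
Lemma majorized_cvg (R : realType) (V : completeNormedModType R[i])
    (u : nat -> V) (t : nat -> R) :
    (forall n, rnorm (u n.+1 - u n) <= t n.+1 - t n) -> (forall n, t n <= 1) ->
  exists l, forall e : R, 0 < e -> \forall n \near \oo, rnorm (u n - l) < e.
Proof.
move=> ut t1.
have t_nd : nondecreasing_seq t.
  by apply/nondecreasing_seqP => n; rewrite -subr_ge0 (le_trans _ (ut n))// rnorm_ge0.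
have utm n m : (n <= m)%N -> rnorm (u m - u n) <= t m - t n.
  move=> /subnK <-; elim: (m - n)%N => [|k ih]; first by rewrite !subrr rnorm0.
  rewrite addSn (le_trans (rdistD (u (k + n)%N) _ _))//.
  by rewrite (le_trans (lerD (ut _) ih))// addrA subrK.
have /cvgrPdist_lt tl : cvgn t.
  by apply: nondecreasing_is_cvgn => //; exists 1 => _ [n _ <-]; exact: t1.
have /cvg_ex[l ul] : cvg (u @ \oo).
  apply/cauchy_cvgP/cauchy_exP => e /gt0_complexE[-> e0].
  have [|n _ tn] := tl (complex.Re e / 2); first by rewrite divr_gt0.
  exists (u n); exists n => //= m nm.
  rewrite -ball_normE /= rnormE ltcR rdistC (le_lt_trans (utm _ _ nm))//.
  have := tn m nm; have := tn n (leqnn n); rewrite !ltr_norml /= => /andP[] ? ? /andP[] ? ?.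
  lra.
by exists l; apply/cvg_rnormP.
Qed.

(** A pair [(a, c)] stands for [a + c 1]. The alias copies only the module structure, so that
    product and norm can be chosen afterwards. *)
Definition unitization (R : realType) (A : cstarAlgType R) : Type :=
  (A * R[i]^o)%type.
HB.instance Definition _ (R : realType) (A : cstarAlgType R) :=
  GRing.Lmodule.copy (unitization A) (A * R[i]^o)%type.

Section UnitizationRing.
Variables (R : realType) (A : cstarAlgType R).
Implicit Types m n p : unitization A.

Lemma cmulBl (a b c : A) : cmul (a - b) c = cmul a c - cmul b c.
Proof. by rewrite cmulDl -scaleN1r cmulZl scaleN1r. Qed.

Lemma cmulBr (a b c : A) : cmul c (a - b) = cmul c a - cmul c b.
Proof. by rewrite cmulDr -scaleN1r cmulZr scaleN1r. Qed.

Lemma cmul0l (a : A) : cmul 0 a = 0.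
Proof. by rewrite -(subrr (0 : A)) cmulBl !subrr. Qed.

Lemma cmul0r (a : A) : cmul a 0 = 0.
Proof. by rewrite -(subrr (0 : A)) cmulBr !subrr. Qed.

Lemma starN (a : A) : star (- a) = - star a.
Proof. by rewrite -(scaleN1r a) starZ rmorphN rmorph1 scaleN1r. Qed.

Lemma starB (a b : A) : star (a - b) = star a - star b.
Proof. by rewrite starD starN. Qed.

Definition umul m n : unitization A :=
  (cmul m.1 n.1 + n.2 *: m.1 + m.2 *: n.1, m.2 * n.2).

Definition uone : unitization A := (0, 1).

Lemma umulA : associative umul.
Proof.
move=> m n p; rewrite /umul /=; congr pair; last by rewrite mulrA.
rewrite !cmulDl !cmulDr !scalerDr !cmulZl !cmulZr !scalerA cmulA.
rewrite (mulrC p.2 m.2) (mulrC n.2 p.2) -!addrA.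
congr (_ + _); rewrite [LHS]addrCA; congr (_ + _).
rewrite [RHS]addrCA; congr (_ + _).
rewrite [LHS]addrCA.
by congr (_ + _); congr (_ + _).
Qed.

Lemma umul1r : left_id uone umul.
Proof. by move=> [a r]; rewrite /umul /= cmul0l scaler0 scale1r !add0r mul1r. Qed.

Lemma umulr1 : right_id uone umul.
Proof. by move=> [a r]; rewrite /umul /= cmul0r scaler0 scale1r add0r addr0 mulr1. Qed.

Lemma umulDl : left_distributive umul +%R.
Proof.
move=> m n p; rewrite /umul /=; congr pair; last by rewrite mulrDl.
by rewrite /= cmulDl !scalerDr scalerDl [RHS]addrACA; congr (_ + _); rewrite addrACA.
Qed.

Lemma umulDr : right_distributive umul +%R.
Proof.
move=> m n p; rewrite /umul /=; congr pair; last by rewrite mulrDr.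
by rewrite /= cmulDr !scalerDr scalerDl [RHS]addrACA; congr (_ + _); rewrite addrACA.
Qed.

Lemma uone_neq0 : uone != 0.
Proof. by apply/negP => /eqP[/eqP]; rewrite oner_eq0. Qed.

Lemma uscaleAl (c : R[i]) m n : c *: umul m n = umul (c *: m) n.
Proof.
rewrite /umul /=; congr pair; last by rewrite /= scalerAl.
by rewrite /= !scalerDr cmulZl !scalerA; congr (_ + _ + _); rewrite mulrC.
Qed.

Lemma uscaleAr (c : R[i]) m n : c *: umul m n = umul m (c *: n).
Proof.
rewrite /umul /=; congr pair; last by rewrite /= scalerAr.
by rewrite /= !scalerDr cmulZr !scalerA; congr (_ + _ + _); rewrite mulrC.
Qed.

End UnitizationRing.

HB.instance Definition _ (R : realType) (A : cstarAlgType R) :=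
  GRing.Zmodule_isNzRing.Build (unitization A) (@umulA R A) (@umul1r R A)
    (@umulr1 R A) (@umulDl R A) (@umulDr R A) (@uone_neq0 R A).
HB.instance Definition _ (R : realType) (A : cstarAlgType R) :=
  GRing.Lmodule_isLalgebra.Build R[i] (unitization A) (@uscaleAl R A).
HB.instance Definition _ (R : realType) (A : cstarAlgType R) :=
  GRing.Lalgebra_isAlgebra.Build R[i] (unitization A) (@uscaleAr R A).

(* A unital normed *-algebra with the C*-identity; the last field is all the
   completeness needed to extract square roots. *)
Record unital_cstar (R : realType) (U : algType R[i]) (st : U -> U)
    (N : U -> R) : Prop := UnitalCstar {
  stK : involutive st ;
  stD : forall m n, st (m + n) = st m + st n ;
  stZ : forall c m, st (c *: m) = conjc c *: st m ;
  stM : forall m n, st (m * n) = st n * st m ;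
  N_ge0 : forall m, 0 <= N m ;
  N_eq0 : forall m, N m <= 0 -> m = 0 ;
  ND : forall m n, N (m + n) <= N m + N n ;
  NZ : forall (c : R[i]) m, N (c *: m) <= rnorm (c : R[i]^o) * N m ;
  NM : forall m n, N (m * n) <= N m * N n ;
  NC : forall m, N m ^+ 2 <= N (st m * m) ;
  N1 : N 1 <= 1 ;
  N_cvg : forall (u : nat -> U) (t : nat -> R),
    (forall n, N (u n.+1 - u n) <= t n.+1 - t n) -> (forall n, t n <= 1) ->
    exists l, forall e : R, 0 < e -> \forall n \near \oo, N (u n - l) < e
}.

Section UnitizationNorm.
Variables (R : realType) (A : cstarAlgType R).
Implicit Types (m n : unitization A) (a b x : A).

Lemma rnorm_cmul a b : rnorm (cmul a b) <= rnorm a * rnorm b.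
Proof. by have := norm_cmul a b; rewrite !rnormE -rmorphM lecR. Qed.

Lemma rnorm_cstar a : rnorm (cmul (star a) a) = rnorm a ^+ 2.
Proof.
by apply: (@complexI R); rewrite -rnormE norm_cstar rnormE rmorphXn.
Qed.

Lemma rnorm_star a : rnorm (star a) = rnorm a.
Proof.
suff le b : rnorm b <= rnorm (star b) by apply/eqP; rewrite eq_le le -{2}(starK a) le.
have [->|b0] := eqVneq b 0; first by rewrite rnorm0.
have b0' : 0 < rnorm b by rewrite rnorm_gt0.
by rewrite -(ler_pM2r b0') -expr2 -rnorm_cstar rnorm_cmul.
Qed.

Definition ustar m : unitization A := (star m.1, conjc m.2).

Definition emb a : unitization A := (a, 0).

(** Left multiplication by [a + c 1] on the ideal [A]; the norm of the unitization is measured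
    through this operator. *)
Definition uact m x : A := cmul m.1 x + m.2 *: x.

Lemma mulUE m n : m * n = (cmul m.1 n.1 + n.2 *: m.1 + m.2 *: n.1, m.2 * n.2).
Proof. by []. Qed.

Lemma emb_uact m x : emb (uact m x) = m * emb x.
Proof. by rewrite mulUE /= mulr0 scale0r addr0. Qed.

Lemma embM a b : emb (cmul a b) = emb a * emb b.
Proof. by rewrite mulUE /= mulr0 !scale0r !addr0. Qed.

Lemma embD a b : emb (a + b) = emb a + emb b.
Proof. by congr pair; rewrite /= addr0. Qed.

Lemma embZ (c : R[i]) a : emb (c *: a) = c *: emb a.
Proof. by congr pair; rewrite /= scaler0. Qed.

Lemma embN a : emb (- a) = - emb a.
Proof. by rewrite -scaleN1r embZ scaleN1r. Qed.

Lemma emb_star a : emb (star a) = ustar (emb a).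
Proof. by congr pair; rewrite -[RHS]/(conjc (0 : R[i])) rmorph0. Qed.

Lemma emb_inj : injective emb.
Proof. by move=> a b []. Qed.

Lemma ustarK : involutive ustar.
Proof. by move=> [a c]; rewrite /ustar /= starK conjcK. Qed.

Lemma ustarD m n : ustar (m + n) = ustar m + ustar n.
Proof. by congr pair; rewrite /= ?starD ?rmorphD. Qed.

Lemma ustarZ (c : R[i]) m : ustar (c *: m) = conjc c *: ustar m.
Proof. by congr pair; rewrite /= ?starZ ?rmorphM. Qed.

Lemma ustarM m n : ustar (m * n) = ustar n * ustar m.
Proof.
rewrite !mulUE /ustar /=; congr pair; last by rewrite rmorphM mulrC.
by rewrite !starD !starZ starM addrAC.
Qed.

Lemma uactM m n x : uact (m * n) x = uact m (uact n x).
Proof. by apply: emb_inj; rewrite !emb_uact mulrA. Qed.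

Lemma uactD m n x : uact (m + n) x = uact m x + uact n x.
Proof. by apply: emb_inj; rewrite embD !emb_uact mulrDl. Qed.

Lemma uactZ (c : R[i]) m x : uact (c *: m) x = c *: uact m x.
Proof. by apply: emb_inj; rewrite embZ !emb_uact scalerAl. Qed.

(* The bound on the scalar part makes the infimum of these bounds a norm even
   when A already has a unit. *)
Definition ubound m (t : R) :=
  (forall x, rnorm (uact m x) <= t * rnorm x) /\ rnorm (m.2 : R[i]^o) <= t.

Definition unorm m : R := inf [set t | ubound m t].

Lemma uboundW m (t s : R) : t <= s -> ubound m t -> ubound m s.
Proof.
move=> ts [h1 h2]; split=> [x|]; last exact: le_trans ts.
by rewrite (le_trans (h1 x))// ler_wpM2r// rnorm_ge0.
Qed.

Lemma ubound_components m : ubound m (rnorm m.1 + rnorm (m.2 : R[i]^o)).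
Proof.
split=> [x|]; last by rewrite lerDr rnorm_ge0.
by rewrite mulrDl (le_trans (rnormD _ _))// lerD ?rnorm_cmul// rnormZ.
Qed.

(** The conditions in [ubound] are closed in [t], so the infimum is itself a bound. Every later
    estimate of [unorm] is reduced to [ubound] by this equivalence. *)
Lemma unorm_le m (t : R) : unorm m <= t <-> ubound m t.
Proof.
have bnd0 s : ubound m s -> 0 <= s by case=> _; apply: le_trans; exact: rnorm_ge0.
have nonempty : [set s | ubound m s] !=set0.
  by exists (rnorm m.1 + rnorm (m.2 : R[i]^o)); exact: ubound_components.
split=> [Nt|mt]; last by apply: ge_inf => //; exists 0 => s; exact: bnd0.
apply: (uboundW Nt); split=> [x|]; last by apply: lb_le_inf => // s [].
have [->|x0] := eqVneq x 0.
  by rewrite /uact cmul0r scaler0 addr0 !rnorm0 mulr0.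
have x0' : 0 < rnorm x by rewrite rnorm_gt0.
rewrite -ler_pdivrMr//; apply: lb_le_inf => // s [ms _].
by rewrite ler_pdivrMr.
Qed.

Lemma uboundN m : ubound m (unorm m).
Proof. by apply/unorm_le. Qed.

Lemma unorm_ge0 m : 0 <= unorm m.
Proof. exact: le_trans (rnorm_ge0 _) (uboundN m).2. Qed.

Lemma unorm_emb a : unorm (emb a) = rnorm a.
Proof.
apply/eqP; rewrite eq_le; apply/andP; split.
  by apply/unorm_le; have := ubound_components (emb a); rewrite /= rnorm0 addr0.
have [->|a0] := eqVneq a 0; first by rewrite rnorm0 unorm_ge0.
have a0' : 0 < rnorm a by rewrite rnorm_gt0.
(* Testing the operator on [star a] gives the lower bound: the C*-identity makes the norm of
   [cmul a (star a)] the square of that of [a]. *)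
have [/(_ (star a)) h _] := uboundN (emb a); rewrite -(ler_pM2r a0').
move: h; rewrite /uact /= scale0r addr0 rnorm_star.
by rewrite -{1}(starK a) rnorm_cstar rnorm_star expr2.
Qed.

(** Removing the scalar part costs at most its modulus, itself bounded by [unorm m]; hence the
    factor 2. It makes both coordinates of a controlled sequence converge. *)
Lemma rnorm_fst_le m : rnorm m.1 <= 2 * unorm m.
Proof.
have <- : unorm (m - m.2 *: 1) = rnorm m.1.
  rewrite -unorm_emb; congr unorm; congr pair; rewrite /=.
    by rewrite scaler0 subr0.
  by rewrite /GRing.scale /= mulr1 subrr.
apply/unorm_le; rewrite mulr_natl mulr2n; have [h1 h2] := uboundN m.
split=> [x|]; last by rewrite /= /GRing.scale /= mulr1 subrr rnorm0 addr_ge0 ?unorm_ge0.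
have -> : uact (m - m.2 *: 1) x = uact m x - m.2 *: x.
  by rewrite uactD -scaleN1r !uactZ scaleN1r /uact /= cmul0l scale1r add0r.
by rewrite (le_trans (rnormB _ _))// mulrDl lerD// rnormZ ler_wpM2r// rnorm_ge0.
Qed.

Lemma unital_cstar_unitization : unital_cstar ustar unorm.
Proof.
have uD m n : unorm (m + n) <= unorm m + unorm n.
  have [m1 m2] := uboundN m; have [n1 n2] := uboundN n.
  apply/unorm_le; split=> [x|]; last by rewrite (le_trans (rnormD _ _))// lerD.
  by rewrite uactD mulrDl (le_trans (rnormD _ _))// lerD.
have uM m n : unorm (m * n) <= unorm m * unorm n.
  have [m1 m2] := uboundN m; have [n1 n2] := uboundN n.
  apply/unorm_le; split=> [x|].
    by rewrite uactM (le_trans (m1 _))// -mulrA ler_wpM2l ?unorm_ge0.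
  by rewrite mulUE /= rnormM ler_pM// rnorm_ge0.
split=> //.
- exact: ustarK.
- exact: ustarD.
- exact: ustarZ.
- exact: ustarM.
- exact: unorm_ge0.
- move=> m m0; have m1 := rnorm_fst_le m; have [_ m2] := uboundN m.
  have m1' : rnorm m.1 == 0.
    by rewrite eq_le rnorm_ge0 andbT (le_trans m1)// pmulr_rle0.
  have m2' : rnorm (m.2 : R[i]^o) == 0 by rewrite eq_le rnorm_ge0 andbT (le_trans m2).
  move: m1' m2'; rewrite !rnorm_eq0 => /eqP m1' /eqP m2'.
  by rewrite [m]surjective_pairing m1' m2'.
- move=> c m; have [m1 m2] := uboundN m.
  apply/unorm_le; split=> [x|].
    by rewrite uactZ rnormZ -mulrA ler_wpM2l// rnorm_ge0.
  by rewrite /= rnormZ ler_wpM2l// rnorm_ge0.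
(* The C*-identity is proved by showing that the square root of [unorm (ustar m * m)] bounds [m]:
   the square of the norm of [m x] is that of [star x] times [m^* m x]. *)
- move=> m; have [m1 m2] := uboundN (ustar m * m).
  rewrite -[unorm m ^+ 2]ger0_norm ?sqr_ge0// -(@ler_sqrt _ _ (unorm _)) ?unorm_ge0//.
  rewrite ger0_norm ?sqr_ge0// sqrtr_sqr ger0_norm ?unorm_ge0//.
  apply/unorm_le; split=> [x|].
    rewrite -(@ler_pXn2r _ 2) ?nnegrE ?rnorm_ge0 ?mulr_ge0 ?sqrtr_ge0 ?rnorm_ge0//.
    rewrite -rnorm_cstar exprMn sqr_sqrtr ?unorm_ge0//.
    have -> : cmul (star (uact m x)) (uact m x) =
              cmul (star x) (uact (ustar m * m) x).
      apply: emb_inj; rewrite !embM !emb_star !emb_uact ustarM.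
      by rewrite -!mulrA.
    rewrite (le_trans (rnorm_cmul _ _))// rnorm_star expr2 mulrCA ler_wpM2l//.
  rewrite -(@ler_pXn2r _ 2) ?nnegrE ?rnorm_ge0 ?sqrtr_ge0// sqr_sqrtr ?unorm_ge0//.
  by rewrite (le_trans _ m2)//= rnormM rnorm_conjc expr2.
- apply/unorm_le; split=> [x|] /=; last by rewrite (rnorm_real 1) normr1.
  by rewrite /uact /= cmul0l add0r scale1r mul1r.
- move=> u t ut t1.
  (* Halving the first coordinate absorbs the factor 2 of [rnorm_fst_le], so that the same majorant
     [t] applies; the limit is doubled back below. *)
  have [|k|l1 ul1] := @majorized_cvg R A (fun k => 2^-1%:C *: (u k).1) t _ _.
  + move=> k; rewrite -scalerBr (le_trans _ (ut k))//.
    rewrite rnormZr ger0_norm// mulrC ler_pdivrMr// mulrC.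
    exact: (rnorm_fst_le (u k.+1 - u k)).
  + exact: t1.
  have [|k|l2 ul2] := @majorized_cvg R (scalars R) (fun k => (u k).2) t _ _.
  + by move=> k; rewrite (le_trans _ (ut k))//; exact: (uboundN (u k.+1 - u k)).2.
  + exact: t1.
  exists (2%:R%:C *: l1, l2) => e e0.
  have e40 : 0 < e / 4 by rewrite divr_gt0.
  have e20 : 0 < e / 2 by rewrite divr_gt0.
  apply: filterS2 (ul1 _ e40) (ul2 _ e20) => k h1 h2.
  rewrite (@le_lt_trans _ _ (rnorm ((u k).1 - 2%:R%:C *: l1) + rnorm ((u k).2 - l2 : scalars R)))//.
    apply/unorm_le; exact: (ubound_components (u k - (_, _))).
  rewrite [e in ltRHS]splitr ltrD//.
  have -> : (u k).1 - 2%:R%:C *: l1 = 2%:R%:C *: (2^-1%:C *: (u k).1 - l1).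
    by rewrite scalerBr scalerA -rmorphM divff// scale1r.
  rewrite rnormZr ger0_norm//; lra.
Qed.

End UnitizationNorm.

(** * Positivity in C*-algebras *)

Section Positivity.
Variables (R : realType) (U : algType R[i]) (st : U -> U) (N : U -> R).
Hypothesis H : unital_cstar st N.
Implicit Types (a b c d h m n r s v w x y : U) (t e : R).

Lemma NZr t m : N (t%:C *: m) = `|t| * N m.
Proof.
have le t' m' : N (t'%:C *: m') <= `|t'| * N m'.
  by rewrite (le_trans (NZ H _ _))// rnorm_real.
have [->|t0] := eqVneq t 0.
  by apply/eqP; rewrite normr0 mul0r eq_le (N_ge0 H) andbT (le_trans (le _ _))// normr0 mul0r.
apply/eqP; rewrite eq_le le /= -ler_pdivlMl ?normr_gt0//.
rewrite -normfV (le_trans _ (le _ _))// scalerA -rmorphM mulVf//.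
by rewrite scale1r.
Qed.

Lemma N0 : N 0 = 0.
Proof. by rewrite -(scale0r 1) -[0](rmorph0 (real_complex R)) NZr normr0 mul0r. Qed.

Lemma NN m : N (- m) = N m.
Proof.
by rewrite -scaleN1r -[-1](rmorphN1 (real_complex R)) NZr normrN1 mul1r.
Qed.

Lemma NBC m n : N (m - n) = N (n - m).
Proof. by rewrite -NN opprB. Qed.

Lemma N_alg_le t : N t%:C%:A <= `|t|.
Proof. by rewrite NZr ler_piMr// (N1 H). Qed.

Lemma N_small m K : (forall e, 0 < e -> N m <= K * e) -> m = 0.
Proof.
move=> mK; apply: (N_eq0 H); apply/ler_addgt0Pl => e e0; rewrite addr0.
have K0 : 0 < `|K| + 1 by rewrite ltr_wpDl.
rewrite (le_trans (mK (e / (`|K| + 1)) _)) ?divr_gt0// mulrA ler_pdivrMr//.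
rewrite mulrC ler_wpM2l ?ltW//.
by rewrite (le_lt_trans (ler_norm _))// ltrDl.
Qed.

Lemma st0 : st 0 = 0.
Proof. by rewrite -(scale0r 0) (stZ H) rmorph0 !scale0r. Qed.

Lemma st1 : st 1 = 1.
Proof. by rewrite -[LHS]mul1r -{1}(stK H 1) -(stM H) mul1r (stK H). Qed.

Lemma stN m : st (- m) = - st m.
Proof. by rewrite -scaleN1r (stZ H) rmorphN1 scaleN1r. Qed.

Lemma stB m n : st (m - n) = st m - st n.
Proof. by rewrite (stD H) stN. Qed.

Lemma stZr t m : st (t%:C *: m) = t%:C *: st m.
Proof. by rewrite (stZ H) conjc_real. Qed.

Lemma st_alg t : st t%:C%:A = t%:C%:A.
Proof. by rewrite stZr st1. Qed.

Lemma Nst m : N (st m) = N m.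
Proof.
suff le n : N n <= N (st n) by apply/eqP; rewrite eq_le le -{2}(stK H m) le.
have := N_ge0 H n; rewrite le_eqVlt => /predU1P[<-|n0]; first exact: N_ge0 H _.
by rewrite -(ler_pM2r n0) -expr2 (le_trans (NC H _))// (NM H).
Qed.

Lemma NCE m : N (st m * m) = N m ^+ 2.
Proof. by apply/eqP; rewrite eq_le (NC H) andbT (le_trans (NM H _ _))// Nst expr2. Qed.

Lemma N_sqr h : st h = h -> N (h * h) = N h ^+ 2.
Proof. by move=> hh; rewrite -NCE hh. Qed.

(** A factorization valid for non-commuting elements: it expresses an increment of the square root
    iteration by the previous one, just as for the scalar majorant. *)
Lemma subr_sqrE a b : a * a - b * b = a * (a - b) + (a - b) * b.
Proof. by rewrite mulrBr mulrBl addrA subrK. Qed.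

(* The iteration u := (b + u^2) / 2 converges to 1 - sqrt (1 - b), and the
   scalar iteration for b := 1 majorises it. *)
Lemma sqrt_1B b : st b = b -> N b <= 1 ->
  exists v, [/\ st v = v, v * v = 1 - b, N (1 - v) <= 1 &
    forall d, d * b = b * d -> d * v = v * d].
Proof.
move=> sb Nb.
pose u := fix u (k : nat) : U := if k is k'.+1 then 2^-1%:C *: (b + u k' * u k') else 0.
pose t := fix t (k : nat) : R := if k is k'.+1 then 2^-1 * (1 + t k' * t k') else 0.
have t0 k : 0 <= t k.
  by elim: k => [|k ih] //=; rewrite mulr_ge0// addr_ge0// mulr_ge0.
have t1 k : t k <= 1.
  elim: k => [|k ih] //=.
  have : t k * t k <= 1 by rewrite mulr_ile1.
  lra.
have half : `|2^-1 : R| = 2^-1 by rewrite ger0_norm.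
have Nu k : N (u k) <= t k.
  elim: k => [|k ih] /=; first by rewrite N0.
  rewrite NZr half ler_wpM2l// (le_trans (ND H _ _))// lerD//.
  by rewrite (le_trans (NM H _ _))// ler_pM// (N_ge0 H).
have Nu1 k : N (u k.+1 - u k) <= t k.+1 - t k.
  elim: k => [|k ih]; first by rewrite !subr0; exact: (Nu 1%N).
  have -> : u k.+2 - u k.+1 = 2^-1%:C *: (u k.+1 * u k.+1 - u k * u k).
    by rewrite /= -scalerBr opprD addrACA subrr add0r.
  have -> : t k.+2 - t k.+1 = 2^-1 * (t k.+1 * (t k.+1 - t k) + (t k.+1 - t k) * t k).
    have tS j : t j.+1 = 2^-1 * (1 + t j * t j) by [].
    by rewrite (tS k.+1) [X in _ - X]tS; ring.
  rewrite NZr half ler_wpM2l// subr_sqrE (le_trans (ND H _ _))//.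
  by rewrite lerD// (le_trans (NM H _ _))// ler_pM// (N_ge0 H).
have [l ul] := N_cvg H Nu1 t1.
have su k : st (u k) = u k.
  by elim: k => [|k ih] /=; rewrite ?st0// stZr (stD H) (stM H) ih sb.
have near_l e : 0 < e -> exists k, N (u k - l) < e /\ N (u k.+1 - l) < e.
  by move=> /ul[k _ kl]; exists k; split; apply: kl => /=.
have Nl : N l <= 1.
  apply/ler_addgt0Pl => e /near_l[k [kl _]].
  by rewrite -(subrK (u k) l) (le_trans (ND H _ _))// lerD ?(le_trans (Nu _))// NBC ltW.
(* The recurrence passes to the limit: one error [e] comes from [u k.+1], and half of two errors [e]
   from the square, hence the constant 2. *)
have l_fix : l - 2^-1%:C *: (b + l * l) = 0.
  apply: (@N_small _ 2) => e /near_l[k [kl k1l]].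
  rewrite -[l in N (l - _)](subrK (u k.+1)) -addrA [u k.+1]/=.
  rewrite -scalerBr opprD addrACA subrr add0r subr_sqrE.
  have e1 : N (u k * (u k - l)) <= e.
    by rewrite (le_trans (NM H _ _))// -[e]mul1r ler_pM ?(N_ge0 H) ?(le_trans (Nu _))// ltW.
  have e2 : N ((u k - l) * l) <= e.
    by rewrite (le_trans (NM H _ _))// -[e]mulr1 ler_pM ?(N_ge0 H)// ltW.
  have e3 := ND H (u k * (u k - l)) ((u k - l) * l).
  have := ND H (l - u k.+1) (2^-1%:C *: (u k * (u k - l) + (u k - l) * l)).
  by rewrite NZr half NBC; lra.
have l2 : l + l = b + l * l.
  move/subr0_eq : l_fix => {1 2}->; rewrite -scalerDl -rmorphD /=.
  by have -> : 2^-1 + 2^-1 = 1 :> R; [lra | rewrite scale1r].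
exists (1 - l); split.
- rewrite stB st1; congr (_ - _); apply: subr0_eq.
  apply: (@N_small _ 2) => e /near_l[k [kl _]].
  rewrite -[st l](subrK (st (u k))) -addrA -stB su.
  have := ND H (st (l - u k)) (u k - l); rewrite Nst [N (l - _)]NBC; lra.
- have -> : b = l + (l - l * l) by rewrite addrA l2 addrK.
  by rewrite mulrBl mul1r mulrBr mulr1 [in RHS]opprD addrA.
- by rewrite opprB addrCA subrr addr0.
- move=> d db; rewrite mulrBl mulrBr mul1r mulr1; congr (_ - _).
  have du k : d * u k = u k * d.
    elim: k => [|k ih] /=; first by rewrite mulr0 mul0r.
    by rewrite -scalerAl -scalerAr mulrDl mulrDr db mulrA ih -!mulrA ih.
  apply: subr0_eq; apply: (@N_small _ (2 * N d)) => e /near_l[k [kl _]].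
  have -> : d * l - l * d = d * (l - u k) + (u k - l) * d.
    by rewrite mulrBr mulrBl addrA du subrK.
  have := ND H (d * (l - u k)) ((u k - l) * d).
  have := NM H d (l - u k); have := NM H (u k - l) d; rewrite [N (l - _)]NBC.
  have : N (u k - l) * N d <= e * N d by rewrite ler_wpM2r ?(N_ge0 H)// ltW.
  lra.
Qed.

(** For selfadjoint [m] the inequality says that the spectrum lies in [[0, 2t]]. In this form,
    stability under sums is just the triangle inequality. *)
Definition psd m := st m = m /\ exists t, N (t%:C%:A - m) <= t.

Lemma psdD a b : psd a -> psd b -> psd (a + b).
Proof.
move=> [sa [t at_]] [sb [e be]]; split; first by rewrite (stD H) sa sb.
exists (t + e); rewrite rmorphD scalerDl opprD addrACA.
by rewrite (le_trans (ND H _ _))// lerD.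
Qed.

Lemma psdZ t a : 0 <= t -> psd a -> psd (t%:C *: a).
Proof.
move=> t0 [sa [e ae]]; split; first by rewrite stZr sa.
by exists (t * e); rewrite rmorphM -scalerA -scalerBr NZr ger0_norm// ler_wpM2l.
Qed.

Lemma psdMn a j : psd a -> psd (a *+ j).
Proof.
move=> pa; elim: j => [|j ih]; last by rewrite mulrS; exact: psdD.
by split; [exact: st0 | exists 0; rewrite subr0 scale0r N0].
Qed.

Lemma psd_1B m : st m = m -> N m <= 1 -> psd (1 - m).
Proof.
move=> sm Nm; split; first by rewrite stB st1 sm.
by exists 1; rewrite scale1r opprB addrCA subrr addr0.
Qed.

(** After scaling by [t], the element [b = 1 - a / t] has norm at most 1 and [sqrt_1B] applies; the
    root is positive because it lies within 1 of the unit before rescaling. The commutation clause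
    is what makes products of commuting positive elements accessible. *)
Lemma psd_root a : psd a -> exists h, [/\ st h = h, h * h = a, psd h &
  forall d, d * a = a * d -> d * h = h * d].
Proof.
move=> [sa [t at_]].
have := le_trans (N_ge0 H _) at_; rewrite le_eqVlt => /predU1P[t0|t0].
  have -> : a = 0.
    by apply/eqP; rewrite -oppr_eq0; apply/eqP/(N_eq0 H); move: at_; rewrite -t0 scale0r add0r.
  exists 0; split; [exact: st0 | exact: mulr0 | | by move=> d _; rewrite mulr0 mul0r].
  by split; [exact: st0 | exists 0; rewrite subr0 scale0r N0].
pose b := 1 - t^-1%:C *: a.
have bE : b = t^-1%:C *: (t%:C%:A - a).
  by rewrite scalerBr scalerA -rmorphM mulVf ?gt_eqF// scale1r.
have [||v [sv vv Nv cv]] := @sqrt_1B b.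
- by rewrite stB st1 stZr sa.
- by rewrite bE NZr gtr0_norm ?invr_gt0// ler_pdivrMl// mulr1.
have st0' : 0 <= Num.sqrt t by exact: sqrtr_ge0.
exists ((Num.sqrt t)%:C *: v); split.
- by rewrite stZr sv.
- rewrite -scalerAl -scalerAr scalerA -rmorphM -expr2 sqr_sqrtr ?ltW// vv.
  by rewrite opprB addrCA subrr addr0 scalerA -rmorphM divff ?gt_eqF// scale1r.
- split; first by rewrite stZr sv.
  by exists (Num.sqrt t); rewrite -scalerBr NZr ger0_norm// ler_piMr.
- move=> d da; rewrite -scalerAl -scalerAr cv//.
  by rewrite mulrBr mulrBl mulr1 mul1r -scalerAl -scalerAr da.
Qed.

Lemma scaler_realMn t j m : t%:C *: (m *+ j) = (t * j%:R)%:C *: m.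
Proof. by rewrite rmorphM rmorph_nat -scalerA scaler_nat. Qed.

Lemma sqrDB h m : (h + m) * (h + m) + (h - m) * (h - m) = (h * h + m * m) *+ 2.
Proof.
have E n : (h + n) * (h + n) = h * h + n * n + (h * n + n * h).
  by rewrite mulrDl !mulrDr [n * h + _]addrC addrACA.
by rewrite !E mulrNN mulrN mulNr -opprD addrACA subrr addr0 mulr2n.
Qed.

Lemma sqrBB h m : (h + m) * (h + m) - (h - m) * (h - m) = (h * m + m * h) *+ 2.
Proof.
have E n : (h + n) * (h + n) = h * h + n * n + (h * n + n * h).
  by rewrite mulrDl !mulrDr [n * h + _]addrC addrACA.
by rewrite !E mulrNN mulrN mulNr -opprD opprB addrCA [h * h + _ + _]addrC addrK mulr2n.
Qed.

(* For selfadjoint h of norm at most 1 and s := sqrt (1 - h^2), the element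
   h + i s is unitary, and 2 h^2 - 1 is the real part of its square. *)
Lemma N_sqrB1 h : st h = h -> N h <= 1 -> N (h * h *+ 2 - 1) <= 1.
Proof.
move=> sh Nh.
have [||s [ss sE _ cs]] := @sqrt_1B (h * h).
- by rewrite (stM H) sh.
- by rewrite N_sqr// expr_le1 ?(N_ge0 H).
pose g : U := 'i *: s.
have gg : g * g = h * h - 1.
  by rewrite -scalerAl -scalerAr scalerA -expr2 sqr_i scaleN1r sE opprB.
have sg : st g = - g.
  rewrite (stZ H) ss -scaleNr; congr (_ *: _).
  by apply/eqP; rewrite eq_complex /= oppr0 !eqxx.
have hg : h * g = g * h by rewrite -scalerAl -scalerAr cs// mulrA.
pose w := h + g; have sw : st w = h - g by rewrite (stD H) sh sg.
have unit : st w * w = 1.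
  rewrite sw mulrBl !mulrDr hg gg opprD addrA addrK opprB addrCA subrr.
  by rewrite addr0.
have Nw : N w <= 1.
  by rewrite -(@expr_le1 _ 2) ?(N_ge0 H)// -NCE unit (N1 H).
have -> : h * h *+ 2 - 1 = 2^-1%:C *: (w * w + st w * st w).
  by rewrite sw sqrDB gg scaler_realMn mulVf// scale1r addrA mulr2n.
rewrite NZr ger0_norm// ler_pdivrMl//.
have := ND H (w * w) (st w * st w); have := NM H w w; have := NM H (st w) (st w).
rewrite Nst; have : N w * N w <= 1 by rewrite mulr_ile1 ?(N_ge0 H).
lra.
Qed.

(** A rescaling of [N_sqrB1]: the spectrum of [h * h] lies in [[0, 2t]], hence within [t] of its
    midpoint. *)
Lemma N_sqrB h t : st h = h -> N h ^+ 2 <= t *+ 2 -> N (t%:C%:A - h * h) <= t.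
Proof.
move=> sh ht; apply/ler_addgt0Pl => e e0.
have t0 : 0 <= t by rewrite -(@pmulrn_lge0 _ _ 2)// (le_trans _ ht)// sqr_ge0.
(* The shift keeps the scaling factor nonzero when [t = 0]; the slack [e / 2] is spent once in [q]
   and once in returning from [q] to [t]. *)
pose q := t + e / 2; have q0 : 0 < q by rewrite ltr_wpDl ?divr_gt0.
pose k := Num.sqrt (q * 2).
have k0 : 0 < k by rewrite sqrtr_gt0 mulr_gt0.
have kk : k ^+ 2 = q * 2 by rewrite sqr_sqrtr// ltW// mulr_gt0.
have hk : N (k^-1%:C *: h) <= 1.
  rewrite NZr gtr0_norm ?invr_gt0// ler_pdivrMl// mulr1.
  by rewrite -(@ler_pXn2r _ 2) ?nnegrE ?(N_ge0 H) ?ltW// kk /q; lra.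
have qh : q%:C%:A - h * h = - (q%:C *: ((k^-1%:C *: h) * (k^-1%:C *: h) *+ 2 - 1)).
  rewrite -scalerAl -scalerAr scalerBr opprB scaler_realMn !scalerA -!rmorphM.
  congr (_ - _); rewrite -[LHS]scale1r; congr (_%:C *: _).
  by rewrite -mulrA -invfM -expr2 kk divff// gt_eqF// mulr_gt0.
have -> : t%:C%:A - h * h = (- (e / 2))%:C%:A + (q%:C%:A - h * h).
  by rewrite addrA -scalerDl -rmorphD /q [- _ + _]addrC addrK.
have Nq : N (q%:C%:A - h * h) <= q.
  rewrite qh NN NZr gtr0_norm// ler_piMr ?(ltW q0)// N_sqrB1//.
  by rewrite stZr sh.
have := ND H (- (e / 2))%:C%:A (q%:C%:A - h * h); have := N_alg_le (- (e / 2)).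
rewrite normrN gtr0_norm ?divr_gt0// /q in Nq *; lra.
Qed.

Lemma psd_sqr h : st h = h -> psd (h * h).
Proof.
move=> sh; split; first by rewrite (stM H) sh.
by exists (N h ^+ 2); apply: N_sqrB => //; rewrite mulr2n lerDl sqr_ge0.
Qed.

(** The unknown [t] in [psd] can be replaced by any number at least half the norm, by writing [a] as
    a square. This quantitative form stands in for the spectral radius. *)
Lemma psd_norm a t : psd a -> N a <= t *+ 2 -> N (t%:C%:A - a) <= t.
Proof. by move=> /psd_root[h [sh <- _ _]]; rewrite N_sqr//; exact: N_sqrB. Qed.

(** The two roots commute, so their product is selfadjoint and squares to [a * b]. *)
Lemma psdM a b : psd a -> psd b -> a * b = b * a -> psd (a * b).
Proof.
move=> /psd_root[r [sr ra _ rc]] /psd_root[s [ss sb _ sc]] ab.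
have rs : r * s = s * r by apply: sc; rewrite rc.
have -> : a * b = (r * s) * (r * s).
  by rewrite -ra -sb -!mulrA; congr (_ * _); rewrite !mulrA rs.
by apply: psd_sqr; rewrite (stM H) sr ss.
Qed.

(** Write [x] and [y] for the norms of [a] and [1 - a]. Centring at half the norm, [psd_norm] gives
    [x <= y/2 + |1 - y/2|] and [y <= x/2 + |1 - x/2|]. If [x > 1], the first forces [y > 2] and
    [x <= y - 1]; the second then forces [y <= x - 1], a contradiction. *)
Lemma psd_le1 a : psd a -> psd (1 - a) -> N a <= 1.
Proof.
move=> pa p1a.
have alg1 t : t%:C%:A - (1 - a) = a - (1 - t)%:C%:A :> U.
  by rewrite opprB addrCA -opprB -{1}(scale1r (1 : U)) -scalerBl -rmorphB.
have tri t : N a <= N (a - t%:C%:A) + `|t|.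
  by rewrite -[a in leLHS](subrK t%:C%:A) (le_trans (ND H _ _))// lerD2l N_alg_le.
have tri2 t : N (1 - a) <= N (t%:C%:A - a) + `|1 - t|.
  rewrite [1 - a](_ : _ = (t%:C%:A - a) + (1 - t)%:C%:A).
    by rewrite (le_trans (ND H _ _))// lerD2l N_alg_le.
  by rewrite rmorphB scalerBl scale1r [RHS]addrC addrA subrK.
have h1 := @psd_norm _ (1 / 2) p1a; have h2 := tri (1 - 1 / 2).
have h3 := @psd_norm _ (N (1 - a) / 2) p1a; have h4 := tri (1 - N (1 - a) / 2).
have h5 := @psd_norm _ (N a / 2) pa; have h6 := tri2 (N a / 2).
move: h1 h2 h3 h4 h5 h6; rewrite !alg1.
set x := N a; set y := N (1 - a).
set X := N (_ - a); set Y := N (a - _); set Z := N (a - _).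
move=> h1 h2 h3 h4 h5 h6.
have {}h3 : Z <= y / 2 by apply: h3; lra.
have {}h5 : X <= x / 2 by apply: h5; lra.
have n1 : `|1 - 1 / 2 : R| = 1 / 2 by rewrite gtr0_norm; lra.
rewrite n1 in h2.
have [y1|y1] := leP y 1; first by have {}h1 : Y <= 1 / 2; [apply: h1; lra | lra].
have n2 (z : R) : (`|z| = z) \/ (`|z| = - z).
  by have [z0|z0] := leP 0 z; [left; rewrite ger0_norm | right; rewrite ltr0_norm].
have [] := n2 (1 - y / 2); have [] := n2 (1 - x / 2); lra.
Qed.

(** For [t] slightly above the norm of [a + b], the element [1 - a / t] is the sum of the positive
    elements [1 - (a + b) / t] and [b / t], so [psd_le1] applies to [a / t]. *)
Lemma psd_mono a b : psd a -> psd b -> N a <= N (a + b).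
Proof.
move=> pa pb; apply/ler_addgt0Pl => e e0.
pose t := e + N (a + b); have t0 : 0 < t by rewrite ltr_wpDr// (N_ge0 H).
have ti0 : 0 <= t^-1 by rewrite invr_ge0 ltW.
have sab : st (a + b) = a + b by rewrite (stD H) pa.1 pb.1.
have : N (t^-1%:C *: a) <= 1; last first.
  by rewrite NZr ger0_norm// ler_pdivrMl// mulr1.
apply: psd_le1; first exact: psdZ.
have -> : 1 - t^-1%:C *: a = (1 - t^-1%:C *: (a + b)) + t^-1%:C *: b.
  by rewrite scalerDr opprD addrA subrK.
apply: psdD; last exact: psdZ.
apply: psd_1B; first by rewrite stZr sab.
by rewrite NZr ger0_norm// ler_pdivrMl// mulr1 lerDr ltW.
Qed.

(* Fukamiya's argument: with norm 1 and c := - st y * y, the polynomial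
   identity st y * (1 - y * st y) * y = - (c + c^2) bounds c + c^2 by 1. *)
Lemma sqr_opp_star_eq0 y r : st r = r -> st y * y = - (r * r) -> y = 0.
Proof.
move=> sr yy; apply: (N_eq0 H); rewrite leNgt; apply/negP => y0.
wlog y1 : y r sr yy y0 / N y = 1.
  move=> /(_ ((N y)^-1%:C *: y) ((N y)^-1%:C *: r)); apply.
  - by rewrite stZr sr.
  - by rewrite stZr -!scalerAl -!scalerAr yy !scalerN.
  - by rewrite NZr gtr0_norm ?invr_gt0// mulVf// gt_eqF.
  - by rewrite NZr gtr0_norm ?invr_gt0// mulVf// gt_eqF.
set c := r * r in yy.
have pc : psd c by exact: psd_sqr.
have Nc : N c = 1 by rewrite -NN -yy NCE y1 expr1n.
(* The sum of [y * st y] and [st y * y] is half the sum of the squares of the selfadjoint elements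
   [y + st y] and [g]; subtracting [st y * y] adds the positive [c]. *)
have pz : psd (y * st y).
  pose g := 'i *: (y - st y).
  have sg : st g = g.
    rewrite (stZ H) stB (stK H) -opprB scalerN -scaleNr; congr (_ *: _).
    by apply/eqP; rewrite eq_complex /= !oppr0 opprK !eqxx.
  have gg : g * g = - ((y - st y) * (y - st y)).
    by rewrite -scalerAl -scalerAr scalerA -expr2 sqr_i scaleN1r.
  have sh : st (y + st y) = y + st y by rewrite (stD H) (stK H) addrC.
  have -> : y * st y = 2^-1%:C *: ((y + st y) * (y + st y) + g * g) + c.
    by rewrite gg sqrBB scaler_realMn mulVf// scale1r yy addrNK.
  by apply: psdD => //; apply: psdZ; [lra | apply: psdD; exact: psd_sqr].
have cc : N (c + c * c) <= 1.
  have -> : c + c * c = - (st y * (1 - y * st y) * y).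
    have -> : st y * (1 - y * st y) * y = - c - c * c.
      rewrite mulrBr mulr1 mulrBl yy; congr (_ - _).
      by rewrite !mulrA yy -[LHS]mulrA yy mulrNN /c mulrA.
    by rewrite opprB opprK addrC.
  rewrite NN (le_trans (NM H _ _))// y1 mulr1 (le_trans (NM H _ _))// Nst y1 mul1r.
  have := @psd_norm _ 1 pz; rewrite scale1r; apply.
  by rewrite -{1}(stK H y) NCE Nst y1 expr1n; lra.
have pcc : psd (c * (1 - c)).
  apply: psdM => //; first by apply: psd_1B; rewrite ?pc.1 ?Nc.
  by rewrite mulrBr mulrBl mulr1 mul1r.
(* This contradicts [N c = 1], by which [2 c^2] has norm 2. It holds because [1 - 2 c^2] is the sum
   of [1 - (c + c^2)] and [c (1 - c)], both positive. *)
have : N ((c * c) *+ 2) <= 1.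
  apply: psd_le1; first exact/psdMn/psd_sqr/pc.1.
  have -> : 1 - c * c *+ 2 = (1 - (c + c * c)) + c * (1 - c).
    rewrite mulrBr mulr1 -addrA; congr (_ + _).
    by rewrite [in RHS]opprD addrACA addNr add0r -opprD mulr2n.
  by apply: psdD => //; apply: psd_1B => //; rewrite (stD H) (stM H) pc.1.
have -> : c * c *+ 2 = 2%:R%:C *: (c * c) by rewrite rmorph_nat scaler_nat.
by rewrite NZr N_sqr ?pc.1// Nc expr1n normr_nat mulr1; lra.
Qed.

(* With h := st x * x, k := |h| and q := k - h, one has st (x q) (x q) =
   - q k q, so x q = 0, which forces q = 0 and h = k. *)
Lemma psd_star x : psd (st x * x).
Proof.
set h := st x * x; have sh : st h = h by rewrite (stM H) (stK H).
have [k [sk kk pk kc]] := psd_root (psd_sqr sh).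
have hk : h * k = k * h by apply: kc; rewrite mulrA.
have [s [ss sE _ sc]] := psd_root pk.
pose q := k - h.
have sq : st q = q by rewrite stB sk sh.
have qs : q * s = s * q by apply: sc; rewrite mulrBr mulrBl hk.
have qhk : q * (k + h) = 0.
  by rewrite mulrBl !mulrDr hk kk [h * h + _]addrC subrr.
have qhq : q * h * q = - (q * k * q).
  apply/eqP; rewrite -addr_eq0 -mulrDl -mulrDr [h + k]addrC qhk mul0r; exact: eqxx.
have qkq : q * k * q = (s * q) * (s * q).
  by rewrite -sE mulrA qs -mulrA.
have xq0 : x * q = 0.
  apply: (@sqr_opp_star_eq0 _ (s * q)); first by rewrite (stM H) ss sq qs.
  by rewrite (stM H) sq mulrA -(mulrA q (st x) x) qhq qkq.
have q0 : q = 0.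
  have qqq : q * q * q = 0.
    have qhq0 : q * h * q = 0.
      have -> : q * h * q = st (x * q) * (x * q) by rewrite (stM H) sq !mulrA.
      by rewrite xq0 mulr0.
    have -> : q * q * q = q * k * q - q * h * q by rewrite -mulrBl -mulrBr.
    by rewrite -[q * k * q]opprK -qhq qhq0 subr0 oppr0.
  (* For selfadjoint [q] the norm of the fourth power is the fourth power of the norm, so a
     vanishing cube forces [q = 0]. *)
  have : N (q * q * (q * q)) = 0 by rewrite mulrA qqq mul0r N0.
  rewrite !N_sqr//; last by rewrite (stM H) sq.
  move/eqP; rewrite !expf_eq0 /= => /eqP Nq0.
  by apply: (N_eq0 H); rewrite Nq0.
by move/subr0_eq : q0 => <-.
Qed.

End Positivity.

Section PsdMore.
Variables (R : realType) (U : algType R[i]) (st : U -> U) (N : U -> R).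
Hypothesis H : unital_cstar st N.
Notation psd := (psd st N).

Lemma psd_conj (m w : U) : psd m -> psd (st w * m * w).
Proof.
move=> /(psd_root H)[h [sh <- _ _]].
have -> : st w * (h * h) * w = st (h * w) * (h * w) by rewrite (stM H) sh !mulrA.
exact: psd_star.
Qed.

(** Closedness needs one [t] for all approximants: those within 1 of [m] have norm at most
    [N m + 1], and [psd_norm] allows this value for each of them. *)
Lemma psd_closed (m : U) :
  (forall e : R, 0 < e -> exists2 p, psd p & N (m - p) <= e) -> psd m.
Proof.
move=> mp; split.
  apply: subr0_eq; apply: (@N_small _ _ _ _ H _ 2) => e /mp[p [sp _] mpe].
  rewrite -[st m](subrK (st p)) -addrA -(stB H) sp.
  have := ND H (st (m - p)) (p - m); rewrite (Nst H) [N (p - m)](NBC H).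
  lra.
exists (N m + 1); apply/ler_addgt0Pl => e e0.
have e10 : 0 < Num.min e 1 by rewrite lt_min e0 ltr01.
have [p pp mpe] := mp _ e10.
have me : N (m - p) <= e by rewrite (le_trans mpe)// ge_min lexx.
have m1 : N (m - p) <= 1 by rewrite (le_trans mpe)// ge_min lexx orbT.
have Np : N p <= N m + 1.
  have := ND H (p - m) m; rewrite subrK [N (p - m)](NBC H); lra.
have := psd_norm H pp (t := N m + 1).
have -> : (N m + 1)%:C%:A - m = (N m + 1)%:C%:A - p + (p - m).
  by rewrite addrA subrK.
have := ND H ((N m + 1)%:C%:A - p) (p - m); rewrite [N (p - m)](NBC H).
have := N_ge0 H m; move=> m0 h1 h2.
have {}h2 := h2 _; have : N p <= (N m + 1) *+ 2 by lra.
move=> /h2; lra.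
Qed.

Lemma psdX (a : U) n : psd a -> psd (a ^+ n).
Proof.
move=> pa; elim: n => [|n ih]; last first.
  by rewrite exprS; apply: psdM => //; exact: commrX.
by rewrite expr0 -[1]mulr1; apply: psd_sqr => //; exact: st1 H.
Qed.

(* c (1 - c)^k decreases in k, and these terms for k <= n sum to
   1 - (1 - c)^(n+1). *)
Lemma N_mul_exp1B (c : U) n : psd c -> psd (1 - c) ->
  N (c * (1 - c) ^+ n) <= n.+1%:R^-1.
Proof.
move=> pc pv; set v := 1 - c in pv *.
have cX k : c * v ^+ k = v ^+ k * c.
  by apply: commrX; rewrite /GRing.comm mulrBr mulrBl mulr1 mul1r.
suff D : psd (1 - v ^+ n.+1 - (c * v ^+ n) *+ n.+1).
  have : N ((c * v ^+ n) *+ n.+1) <= 1.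
    apply: (psd_le1 H); first by apply: psdMn => //; apply: psdM => //; exact: psdX.
    have := psdD H D (psdX n.+1 pv).
    by rewrite addrAC subrK.
  have -> : c * v ^+ n *+ n.+1 = n.+1%:R%:C *: (c * v ^+ n).
    by rewrite rmorph_nat scaler_nat.
  by rewrite (NZr H) normr_nat -ler_pdivlMl ?ltr0Sn// mulr1.
elim: n => [|n ih].
  rewrite expr1 expr0 mulr1 /v mulr1n opprB addrCA subrr addr0 subrr.
  by rewrite -(mulr0 0); apply: psd_sqr => //; exact: st0 H.
have cx : c * (c * v ^+ n) = c * v ^+ n * c by rewrite -[in RHS]mulrA -cX.
have {ih} := psdD H ih (psdMn H n.+1 (psdM H pc (psdM H pc (psdX n pv) (cX n)) cx)).
set w := v ^+ n; set x := c * w; set y := c * x.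
have vw : v ^+ n.+1 = w - x by rewrite exprS mulrBl mul1r.
have vw2 : v ^+ n.+2 = w - x - (x - y) by rewrite exprS vw mulrBl mul1r mulrBr.
have cv : c * v ^+ n.+1 = x - y by rewrite vw mulrBr.
have xyn : (x - y) *+ n.+2 = (x - y) + (x *+ n.+1 - y *+ n.+1).
  by rewrite [LHS]mulrS mulrnBl.
rewrite vw2 cv vw xyn.
suff -> (q z p r : U) : 1 - (q - z) - (z + (p - r)) = 1 - q - p + r by [].
have -> : 1 - (q - z) = z + (1 - q) by rewrite opprB addrCA.
by rewrite opprD addrACA subrr add0r opprB addrA addrAC.
Qed.
End PsdMore.

(** * Positive elements and approximate units in a possibly non-unital algebra *)

Section Positive.
Variables (R : realType) (A : cstarAlgType R).
Implicit Types a b c : A.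
Let H := unital_cstar_unitization A.

Definition pos a := psd (@ustar R A) (@unorm R A) (emb a).

Lemma pos_selfadj a : pos a -> star a = a.
Proof. by case; rewrite -emb_star => /emb_inj. Qed.

Lemma posD a b : pos a -> pos b -> pos (a + b).
Proof. by rewrite /pos embD; exact: psdD. Qed.

Lemma posZ (t : R) a : 0 <= t -> pos a -> pos (t%:C *: a).
Proof. by rewrite /pos embZ; exact: psdZ. Qed.

Lemma pos_cstar a : pos (cmul (star a) a).
Proof. by rewrite /pos embM emb_star; exact: psd_star. Qed.

Lemma pos0 : pos 0.
Proof. by have := pos_cstar 0; rewrite cmul0r. Qed.

Lemma pos_mono a b : pos a -> pos b -> rnorm a <= rnorm (a + b).
Proof. by rewrite -!unorm_emb embD; exact: psd_mono. Qed.

Lemma pos_sum (I : Type) (s : seq I) (f : I -> A) :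
  (forall i, pos (f i)) -> pos (\sum_(i <- s) f i).
Proof. move=> pf; apply: (big_ind pos) => [|a b|i _]; [exact: pos0|exact: posD|exact: pf]. Qed.

Lemma pos_closed a :
  (forall e : R, 0 < e -> exists2 b, pos b & rnorm (a - b) <= e) -> pos a.
Proof.
move=> ab; apply: psd_closed => // e /ab[b pb abe].
by exists (emb b) => //; rewrite -embN -embD unorm_emb.
Qed.

(** In the unitization, [rnorm b] times the unit minus [b] is positive; conjugating by [c] brings
    the inequality back into [A]. *)
Lemma pos_conj_norm b c : star b = b ->
  pos ((rnorm b)%:C *: cmul (star c) c - cmul (star c) (cmul b c)).
Proof.
move=> sb.
have : psd (@ustar R A) (@unorm R A) ((rnorm b)%:C%:A - emb b).
  split; first by rewrite (stB H) (st_alg H) -emb_star sb.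
  by exists (rnorm b); rewrite opprB addrCA subrr addr0 unorm_emb.
move=> /(psd_conj H (emb c)); rewrite /pos; congr psd.
rewrite embD embN embZ !embM emb_star mulrBr mulrBl -scalerAr mulr1 -scalerAl.
by rewrite mulrA.
Qed.

(* u := 1 - (1 - c)^n, where c is proportional to the sum of the star a * a. *)
Lemma approximate_unit (s : seq A) (e : R) : 0 < e ->
  exists u : A, [/\ star u = u,
    forall a, rnorm (a - cmul a u) <= rnorm a,
    forall a, rnorm (a - cmul u a) <= rnorm a,
    forall a, a \in s -> rnorm (a - cmul a u) <= e &
    forall a, a \in s -> rnorm (a - cmul u a) <= e].
Proof.
move=> e0.
(* Adding the adjoints lets the estimate for left multiplication by [u] follow from the one on the
   right. *)
pose s' := s ++ map star s.
pose c0 := \sum_(a <- s') cmul (star a) a.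
pose k := rnorm c0 + 1; have k0 : 0 < k by rewrite ltr_wpDl.
pose c := k^-1%:C *: c0.
have pc0 : pos c0 by apply: pos_sum => a; exact: pos_cstar.
have pc : pos c by apply: posZ => //; rewrite invr_ge0 ltW.
have Nc : rnorm c <= 1.
  by rewrite rnormZr gtr0_norm ?invr_gt0// ler_pdivrMl// mulr1 lerDl.
pose v := 1 - emb c.
have sc : ustar (emb c) = emb c by rewrite -emb_star pos_selfadj.
have pv : psd (@ustar R A) (@unorm R A) v by apply: psd_1B; rewrite ?unorm_emb.
have Nv : unorm v <= 1.
  by have := @psd_norm _ _ _ _ H _ 1 pc; rewrite scale1r unorm_emb; apply; lra.
have v2 n : (v ^+ n).2 = 1.
  by elim: n => [|n ih]//; rewrite exprS mulUE /= ih mulr1 subr0.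
have NvX n : unorm (v ^+ n) <= 1.
  elim: n => [|n ih]; first by rewrite expr0; exact: N1 H.
  by rewrite exprS (le_trans (NM H _ _))// mulr_ile1 ?(N_ge0 H).
have [n nk] : exists n : nat, k / e ^+ 2 <= n%:R.
  by exists (Num.truncn (k / e ^+ 2)).+1; exact/ltW/truncnS_gt.
pose u := - (v ^+ n).1.
(* Powers of [v] have scalar part 1, so [1 - v ^+ n] falls back into [A]. *)
have uE : emb u = 1 - v ^+ n.
  by rewrite [v ^+ n]surjective_pairing v2; congr pair; rewrite /= ?sub0r ?subrr.
have svX j : ustar (v ^+ j) = v ^+ j by have [] := psdX H j pv.
have su : star u = u.
  by apply: emb_inj; rewrite emb_star uE (stB H) (st1 H) svX.
have rE a : emb (a - cmul a u) = emb a * v ^+ n.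
  by rewrite embD embN embM uE mulrBr mulr1 opprB addrCA subrr addr0.
have lE a : emb (a - cmul u a) = v ^+ n * emb a.
  by rewrite embD embN embM uE mulrBl mul1r opprB addrCA subrr addr0.
(* The square of the norm of [a v^n] is at most that of [v^n c0 v^n], since [c0] dominates the
   summand of [a]. This equals [k] times the norm of [c v^(2n)], at most [k / (2n + 1)], and [n] was
   taken with [k / e^2 <= n]. *)
have small a : a \in s' -> rnorm (a - cmul a u) <= e.
  move=> as'.
  have en : e \is Num.nneg by rewrite nnegrE ltW.
  suff : rnorm (a - cmul a u) ^+ 2 <= e ^+ 2 by rewrite ler_pXn2r// nnegrE.
  rewrite -unorm_emb rE -(NCE H).
  rewrite (@le_trans _ _ (unorm (v ^+ n * emb c0 * v ^+ n)))//.
    have pd : pos (c0 - cmul (star a) a).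
      rewrite /c0 (perm_big _ (perm_to_rem as')) big_cons /= addrC addrK.
      by apply: pos_sum => b; exact: pos_cstar.
    have := psd_mono H (psd_star H (emb a * v ^+ n)) (psd_conj H (v ^+ n) pd).
    rewrite (stM H) svX -emb_star embD embN embM mulrBr mulrBl !mulrA.
    by rewrite addrC subrK.
  have -> : v ^+ n * emb c0 * v ^+ n = k%:C *: (emb c * v ^+ (n + n)).
    rewrite embZ -scalerAl scalerA -rmorphM divff ?gt_eqF// scale1r exprD mulrA.
    congr (_ * _); apply/esym/commrX; rewrite /GRing.comm mulrBr mulrBl mulr1 mul1r.
    by congr (_ - _); rewrite embZ -scalerAr -scalerAl.
  rewrite (NZr H) gtr0_norm// (le_trans (ler_wpM2l (ltW k0) (N_mul_exp1B H _ pc pv)))//.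
  rewrite ler_pdivrMr ?ltr0Sn//.
  have : k <= n%:R * e ^+ 2 by rewrite -ler_pdivrMr ?exprn_gt0.
  move=> /le_trans; apply; rewrite mulrC ler_wpM2l ?sqr_ge0// ler_nat.
  by rewrite leqW// leq_addr.
exists u; split=> // a.
- by rewrite -!unorm_emb rE (le_trans (NM H _ _))// ler_piMr ?(N_ge0 H).
- by rewrite -!unorm_emb lE (le_trans (NM H _ _))// ler_piMl ?(N_ge0 H).
- by move=> sa; apply: small; rewrite mem_cat sa.
- move=> sa; rewrite -rnorm_star starB starM su.
  by apply: small; rewrite mem_cat map_f ?orbT.
Qed.

End Positive.

(** * Bochner integrals of continuous functions *)

Section PartitionSums.
Variables (R : realType) (G : topologicalGroupType).
Variable mu : probability (borel G) R.
Implicit Types T : finType.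

Definition mass (E : set G) : R := fine (mu (E : set (borel G))).

(** A finite measurable partition is encoded by its index map: pairing two maps gives the common
    refinement, and cells may be empty. *)
Definition mindex T (idx : G -> T) :=
  forall i, measurable (idx @^-1` [set i] : set (borel G)).

Lemma massE (E : set G) : measurable (E : set (borel G)) -> mu E = (mass E)%:E.
Proof. by move=> mE; rewrite fineK// fin_num_measure. Qed.

Lemma mass_ge0 (E : set G) : 0 <= mass E.
Proof. by rewrite fine_ge0. Qed.

Lemma mass_comp T1 T2 (idx : G -> T1) (q : T1 -> T2) (t : T2) : mindex idx ->
  mass ((q \o idx) @^-1` [set t]) =
  \sum_(u | q u == t) mass (idx @^-1` [set u]).
Proof.
move=> midx; pose r := [seq u <- index_enum T1 | q u == t].
have -> : (q \o idx) @^-1` [set t] = \bigcup_(u in [set` r]) (idx @^-1` [set u]).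
  apply/seteqP; split=> h /=; last first.
    by move=> [u /=]; rewrite mem_filter => /andP[/eqP <- _] /= ->.
  by move=> qt; exists (idx h); rewrite //= mem_filter qt eqxx mem_index_enum.
rewrite /mass measure_fin_bigcup//.
- rewrite -fsbig_seq ?filter_uniq ?index_enum_uniq// big_filter.
  rewrite (eq_bigr (fun u => (mass (idx @^-1` [set u]))%:E)).
    by rewrite sumEFin.
  by move=> u _; exact: massE.
- by move=> u v _ _ [h [/= <- <-]].
Qed.

Lemma mindex_pair T1 T2 (idx1 : G -> T1) (idx2 : G -> T2) : mindex idx1 -> mindex idx2 ->
  mindex (fun h => (idx1 h, idx2 h)).
Proof.
move=> m1 m2 [t u].
have -> : (fun h => (idx1 h, idx2 h)) @^-1` [set (t, u)] =
    (idx1 @^-1` [set t]) `&` (idx2 @^-1` [set u]).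
  by apply/seteqP; split=> h /= [<- <-].
exact: measurableI.
Qed.

Lemma sum_mass T (idx : G -> T) : mindex idx ->
  \sum_u mass (idx @^-1` [set u]) = 1.
Proof.
move=> midx; have := @mass_comp T unit idx (fun=> tt) tt midx.
have -> : (((fun=> tt) : T -> unit) \o idx) @^-1` [set tt] = setT by apply/seteqP; split.
rewrite /mass probability_setT /= => ->; exact: eq_bigl.
Qed.

Lemma mass_set0 : mass set0 = 0.
Proof. by rewrite /mass measure0. Qed.

Section Weighted.
Variable V : normedModType R[i].

(** The integral of the step function [v \o idx], summed over indices rather than over values, so
    that refining the partition is mere reindexing. *)
Definition wsum T (idx : G -> T) (v : T -> V) : V :=
  \sum_t (mass (idx @^-1` [set t]))%:C *: v t.

Lemma wsum_comp T1 T2 (idx : G -> T1) (q : T1 -> T2) (v : T2 -> V) : mindex idx ->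
  wsum (q \o idx) v = wsum idx (v \o q).
Proof.
move=> midx; rewrite /wsum (partition_big q xpredT)//=; apply: eq_bigr => t _.
rewrite mass_comp// rmorph_sum scaler_suml; apply: eq_bigr => u /eqP <-; exact: erefl.
Qed.

Lemma wsum_dist T1 T2 (idx1 : G -> T1) (idx2 : G -> T2) (v : T1 -> V) (w : T2 -> V) :
  mindex idx1 -> mindex idx2 ->
  rnorm (wsum idx1 v - wsum idx2 w) <=
  \sum_u mass ((fun h => (idx1 h, idx2 h)) @^-1` [set u]) * rnorm (v u.1 - w u.2).
Proof.
move=> m1 m2; pose idx h := (idx1 h, idx2 h); have midx : mindex idx by exact: mindex_pair.
have -> : wsum idx1 v = wsum idx (v \o fst) by exact: (@wsum_comp _ _ idx fst v midx).
have -> : wsum idx2 w = wsum idx (w \o snd) by exact: (@wsum_comp _ _ idx snd w midx).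
rewrite /wsum -sumrB (le_trans (rnorm_sum _ _))//; apply: ler_sum => u _.
by rewrite -scalerBr rnormZr ger0_norm// mass_ge0.
Qed.

Lemma wsum_dist_le T1 T2 (idx1 : G -> T1) (idx2 : G -> T2) (v : T1 -> V) (w : T2 -> V)
    (e : R) : mindex idx1 -> mindex idx2 ->
  (forall h, rnorm (v (idx1 h) - w (idx2 h)) <= e) ->
  rnorm (wsum idx1 v - wsum idx2 w) <= e.
Proof.
move=> m1 m2 vw; rewrite (le_trans (wsum_dist _ _ m1 m2))//.
rewrite -[e]mul1r -(sum_mass (mindex_pair m1 m2)) mulr_suml; apply: ler_sum => u _.
(* An empty cell of the refinement has mass 0; a nonempty one contains a point [h] at which the
   hypothesis applies. *)
have [->|/set0P[h <-]] := eqVneq ((fun h => (idx1 h, idx2 h)) @^-1` [set u]) set0.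
  by rewrite mass_set0 !mul0r.
by rewrite ler_wpM2l ?mass_ge0//; exact: vw.
Qed.

End Weighted.

(** The integral of a nonnegative function is a supremum over simple functions below it. This gives
    monotonicity for distance functions such as those in [is_bochner_integral], whose measurability
    is not established. *)
Lemma integral_mono (f g : G -> R) : (forall h, 0 <= f h) -> (forall h, f h <= g h) ->
  (\int[mu]_h (f h)%:E <= \int[mu]_h (g h)%:E)%E.
Proof.
move=> f0 fg; have g0 h : 0 <= g h by exact: le_trans (fg h).
rewrite ge0_integralTE; last by move=> h; rewrite lee_fin f0.
rewrite ge0_integralTE; last by move=> h; rewrite lee_fin g0.
apply: le_ereal_sup => _ [s sf <-]; exists s => // h.
by rewrite (le_trans (sf h))// lee_fin.
Qed.

Lemma sum_mass_le_integral T (idx : G -> T) (d : T -> R) (g : G -> R) : mindex idx ->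
  (forall t, 0 <= d t) -> (forall h, d (idx h) <= g h) ->
  ((\sum_t mass (idx @^-1` [set t]) * d t)%:E <= \int[mu]_h (g h)%:E)%E.
Proof.
move=> midx d0 dg.
apply: (@le_trans _ _ (\int[mu]_h (d (idx h))%:E)%E); last first.
  exact: integral_mono.
have -> : (fun h => (d (idx h))%:E) =
    (fun h => \sum_t (d t * \1_(idx @^-1` [set t]) h)%:E)%E.
  apply/funext => h; rewrite sumEFin (bigD1 (idx h))//= big1 ?addr0.
    by rewrite indicE mem_set// mulr1.
  by move=> t tn; rewrite indicE memNset ?mulr0//= => /esym; apply/eqP.
rewrite ge0_integral_sum//.
- rewrite -sumEFin; apply: lee_sum => t _.
  rewrite (@integralZl_indic _ _ _ mu setT measurableT (fun=> idx @^-1` [set t]) (d t))//;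
    last by move=> /lt_geF; rewrite d0.
  by rewrite integral_indic// setIT EFinM muleC -massE.
- move=> t; apply/measurable_EFinP; apply: measurable_funM => //; exact: measurable_indic.
- by move=> t h _; rewrite lee_fin mulr_ge0.
Qed.

End PartitionSums.

Section BochnerContinuous.
Variables (R : realType) (G : topologicalGroupType).
Variable mu : probability (borel G) R.
Hypothesis compactG : compact [set: G].

(** A finite subcover is made disjoint by sending [h] to the first member whose interior contains
    it; each cell is an open set minus finitely many open sets. *)
Lemma fine_partition (U : G -> set G) : (forall x, nbhs x (U x)) ->
  exists (T : finType) (idx : G -> T) (pt : T -> G),
    mindex idx /\ forall h, U (pt (idx h)) h.
Proof.
move=> nU; move: compactG; rewrite compact_cover.
move=> /(_ G setT (fun x => (U x)^°)) [x _|h _|D _ cD]; first exact: open_interior.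
  by exists h => //; exact: nU.
have hD h : has (fun x => `[< (U x)^° h >]) D.
  have [x /= xD Uxh] := cD h Logic.I.
  by apply/hasP; exists x => //; apply/asboolP.
have fD h : (find (fun x => `[< (U x)^° h >]) D < size D)%N by rewrite -has_find.
pose pt (i : 'I_(size D)) := nth point D i.
exists 'I_(size D), (fun h => Ordinal (fD h)), pt; split=> [i|h]; last first.
  by apply: interior_subset; have /asboolP := nth_find point (hD h).
have -> : (fun h => Ordinal (fD h)) @^-1` [set i] =
    (U (pt i))^° `&` \bigcap_(j in [set j : 'I_(size D) | (j < i)%N]) ~` (U (pt j))^°.
  apply/seteqP; split=> h /=.
    move=> <-; split=> /=; first by have /asboolP := nth_find point (hD h).
    by move=> j /= /(before_find point) /asboolPn.
  move=> [Ui Uj]; apply/val_inj => /=.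
  have [lt|lt|//] := ltngtP (find (fun x => `[< (U x)^° h >]) D) i.
    have /asboolP Uf := nth_find point (hD h).
    by have := Uj (Ordinal (fD h)) lt Uf.
  by have := before_find point lt; rewrite asboolT.
apply: measurableI; first by apply: sub_sigma_algebra; exact: open_interior.
apply: fin_bigcap_measurable => // j _.
by apply: measurableC; apply: sub_sigma_algebra; exact: open_interior.
Qed.

Section Valued.
Variable V : completeNormedModType R[i].
Implicit Types (f : G -> V) (x : V).

Lemma fimfun_wsum (s : {fimfun G >-> V}) :
    (forall a, measurable (s @^-1` [set a] : set (borel G))) ->
  exists (T : finType) (idx : G -> T) (w : T -> V),
    [/\ mindex idx, forall h, s h = w (idx h) &
        simple_integral mu s = wsum mu idx w].
Proof.
move=> ms; pose r : seq V := fset_set (range s).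
have sr h : s h \in r by rewrite in_fset_set// mem_set.
have ir h : (index (s h) r < size r)%N by rewrite index_mem.
pose idx h := Ordinal (ir h).
have fib i : idx @^-1` [set i] = s @^-1` [set nth 0 r i].
  apply/seteqP; split=> h /=; first by move=> <-; rewrite /= nth_index.
  by move=> shi; apply/val_inj; rewrite /= shi index_uniq ?fset_uniq.
exists 'I_(size r), idx, (fun i : 'I_(size r) => nth 0 r i); split.
- by move=> i; rewrite fib; exact: ms.
- by move=> h; rewrite /= nth_index.
- rewrite /simple_integral fsbig_finite//= -/r (big_nth 0) big_mkord /wsum.
  by apply: eq_bigr => i _; rewrite fib.
Qed.

(** The fundamental estimate, from which the properties of the integral are derived. After refining
    against a step function [s n], the distance to [v] exceeds [e] by at most the distance from [f]
    to [s n], whose integral tends to 0. *)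
Lemma bochner_wsum f x (T : finType) (idx : G -> T) (v : T -> V) (e : R) :
  is_bochner_integral mu f x -> mindex idx ->
  (forall h, rnorm (f h - v (idx h)) <= e) -> rnorm (x - wsum mu idx v) <= e.
Proof.
move=> [s [ms fs sx]] midx fv; apply/ler_addgt0Pl => d d0.
have d20 : 0 < d / 2 by rewrite divr_gt0.
move/cvg_rnormP : sx => /(_ _ d20) sx.
move/fine_cvgP : fs => [fs_fin /cvgrPdist_lt /(_ _ d20) fs].
near \oo => n.
have [T' [idx' [w [midx' sw sE]]]] := fimfun_wsum (ms n).
have fin : (\int[mu]_h (rnorm (f h - s n h))%:E \is a fin_num)%E by near: n.
have le_d : fine (\int[mu]_h (rnorm (f h - s n h))%:E)%E <= d / 2.
  have : `|0 - fine (\int[mu]_h (rnorm (f h - s n h))%:E)%E| < d / 2 by near: n.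
  by rewrite sub0r normrN => /ltW; apply: le_trans; exact: ler_norm.
have xs : rnorm (simple_integral mu (s n) - x) < d / 2 by near: n.
have m2 := mindex_pair midx' midx.
suff ws : rnorm (wsum mu idx' w - wsum mu idx v) <= d / 2 + e.
  have := rdistD (wsum mu idx' w) x (wsum mu idx v).
  rewrite sE rdistC in xs; lra.
rewrite (le_trans (wsum_dist _ _ _ midx' midx))//.
(* The excess over [e] is truncated at 0 to be a nonnegative step function below the integrand;
   adding [e] back uses total mass 1. *)
pose g u := Num.max (rnorm (w u.1 - v u.2) - e) 0.
have : \sum_u mass mu ((fun h => (idx' h, idx h)) @^-1` [set u]) * g u <= d / 2.
  rewrite (le_trans _ le_d)// -lee_fin fineK//.
  apply: sum_mass_le_integral => // [u|h].
    by rewrite /g le_max lexx orbT.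
  rewrite /g ge_max rnorm_ge0 andbT /= -sw lerBlDr.
  by rewrite (le_trans (rdistD (f h) _ _))// rdistC lerD2l.
move=> le_g; apply: (@le_trans _ _ (\sum_u
    (mass mu ((fun h => (idx' h, idx h)) @^-1` [set u]) * g u +
     mass mu ((fun h => (idx' h, idx h)) @^-1` [set u]) * e))).
  apply: ler_sum => u _; rewrite -mulrDr ler_wpM2l ?mass_ge0// -lerBlDr.
  by rewrite /g le_max lexx.
by rewrite big_split/= -mulr_suml sum_mass// mul1r lerD2r.
Unshelve. all: by end_near. Qed.

Definition simple_of (T : finType) (idx : G -> T) (v : T -> V) : G -> V := v \o idx.

Lemma simple_of_finite (T : finType) (idx : G -> T) (v : T -> V) :
  finite_set (range (simple_of idx v)).
Proof.
apply: (@sub_finite_set _ _ (v @` setT)); last exact: finite_image.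
by move=> _ [h _ <-]; exists (idx h).
Qed.

HB.instance Definition _ (T : finType) (idx : G -> T) (v : T -> V) :=
  FiniteImage.Build G V (simple_of idx v) (simple_of_finite idx v).

Lemma measurable_simple_of (T : finType) (idx : G -> T) (v : T -> V) a :
  mindex idx -> measurable (simple_of idx v @^-1` [set a] : set (borel G)).
Proof.
move=> midx.
have -> : simple_of idx v @^-1` [set a] =
    \bigcup_(t in [set t | v t = a]) (idx @^-1` [set t]).
  apply/seteqP; split=> h /=; first by move=> va; exists (idx h).
  by move=> [t /= <- <-].
by apply: fin_bigcup_measurable => // t _; exact: midx.
Qed.

Lemma simple_integral_of (T : finType) (idx : G -> T) (v : T -> V) :
  mindex idx -> simple_integral mu (simple_of idx v) = wsum mu idx v.
Proof.
move=> midx.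
have [|T' [idx' [w [midx' sw ->]]]] := @fimfun_wsum (simple_of idx v).
  by move=> a; exact: measurable_simple_of.
apply/eqP; rewrite -subr_eq0 -rnorm_eq0 eq_le rnorm_ge0 andbT.
by apply: wsum_dist_le => // h; rewrite -sw subrr rnorm0.
Qed.

Lemma continuous_rnormP f : continuous f <->
  forall (g : G) (e : R), 0 < e -> \forall h \near g, rnorm (f h - f g) < e.
Proof.
split=> [cf x|cf x]; first by move/cvg_rnormP : (cf x).
by apply/cvg_rnormP => e; exact: cf.
Qed.

(** Partitions of oscillation at most [1 / (n + 1)] give step functions uniformly that close to [f].
    Their sums are Cauchy by [wsum_dist_le], and the integrated distance is at most that
    constant. *)
Lemma bochner_integrable f : continuous f -> exists x, is_bochner_integral mu f x.
Proof.
move=> /continuous_rnormP cf.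
have part (n : nat) : exists p : {T : finType & ((G -> T) * (T -> V))%type},
    mindex (projT2 p).1 /\
    forall h, rnorm (f h - (projT2 p).2 ((projT2 p).1 h)) <= n.+1%:R^-1.
  have [|T [idx [pt [midx fpt]]]] := @fine_partition
      (fun g => [set h | rnorm (f h - f g) < n.+1%:R^-1]).
    by move=> x; apply: cf; rewrite invr_gt0.
  exists (existT _ T (idx, f \o pt)); split=> //= h.
  exact/ltW/fpt.
have {part} /choice[p pP] := part.
pose s n : {fimfun G >-> V} := simple_of (projT2 (p n)).1 (projT2 (p n)).2.
have sI n : simple_integral mu (s n) = wsum mu (projT2 (p n)).1 (projT2 (p n)).2.
  by apply: simple_integral_of; have [] := pP n.
have /cvg_ex[x sx] : cvg ((fun n => simple_integral mu (s n)) @ \oo).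
  apply/cauchy_cvgP/cauchy_exP => e /gt0_complexE[-> e0].
  have e20 : 0 < complex.Re e / 2 by rewrite divr_gt0.
  have [n nP] : exists n : nat, n.+1%:R^-1 < complex.Re e / 2.
    exists (Num.truncn (complex.Re e / 2)^-1).
    by rewrite -[ltRHS]invrK ltf_pV2 ?posrE ?invr_gt0// truncnS_gt.
  exists (simple_integral mu (s n)); exists n => //= m nm.
  rewrite -ball_normE /= rnormE ltcR !sI.
  have [m1 f1] := pP n; have [m2 f2] := pP m.
  rewrite (@le_lt_trans _ _ (n.+1%:R^-1 + m.+1%:R^-1))//.
    apply: wsum_dist_le => // h.
    by rewrite (le_trans (rdistD (f h) _ _))// lerD// rdistC.
  rewrite [ltRHS]splitr ltrD// (le_lt_trans _ nP)//.
  by rewrite lef_pV2 ?posrE// ler_nat.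
exists x; exists s; split=> //.
  by move=> n a; apply: measurable_simple_of; have [] := pP n.
have inv0 : (fun n => (n.+1%:R^-1 : R)%:E)%E @ \oo --> 0%E.
  by apply/fine_cvgP; split; [exact: nearW | exact: cvg_harmonic].
apply: (@squeeze_cvge _ _ _ _ (cst 0%E) _ _ _ _ _ inv0); last exact: cvg_cst.
apply: nearW => n; rewrite integral_ge0//=; last by move=> h _; rewrite lee_fin rnorm_ge0.
have := @integral_mono R G mu (fun h => rnorm (f h - s n h)) (cst n.+1%:R^-1).
have -> : (\int[mu]_h (cst n.+1%:R^-1 h)%:E = (n.+1%:R^-1)%:E)%E.
  transitivity ((n.+1%:R^-1)%:E * mu [set: borel G])%E.
    exact: (@integral_cst _ _ _ mu setT measurableT (n.+1%:R^-1)%:E).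
  by rewrite probability_setT mule1.
by apply => // h; have [_ ] := pP n; exact.
Qed.

End Valued.
End BochnerContinuous.

Lemma continuous_const (X Y : topologicalType) (a : Y) : continuous (fun _ : X => a).
Proof. by move=> x; exact: cvg_cst. Qed.

Lemma continuous_addr (R : realType) (X : topologicalType) (V : normedModType R[i])
    (f k : X -> V) : continuous f -> continuous k -> continuous (fun x => f x + k x).
Proof. by move=> cf ck x; apply: cvgD; [exact: cf | exact: ck]. Qed.

(** * Linearity, positivity, invariance and exchange of integrals *)

Section IntegralTheory.
Variables (R : realType) (G : topologicalGroupType).
Variable mu : probability (borel G) R.
Hypothesis compactG : compact [set: G].
Local Notation I f := (bochner_integral mu f).
Implicit Types V W : completeNormedModType R[i].

Lemma eq_bochner V (f f' : G -> V) : f =1 f' -> I f = I f'.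
Proof. by move=> /funext ->. Qed.

Lemma rnorm_small V (x : V) (K : R) : (forall e : R, 0 < e -> rnorm x <= K * e) -> x = 0.
Proof.
move=> xK; apply/eqP; rewrite -rnorm_eq0 eq_le rnorm_ge0 andbT.
apply/ler_addgt0Pl => e e0; rewrite addr0.
have K0 : 0 < `|K| + 1 by rewrite ltr_wpDl.
rewrite (le_trans (xK (e / (`|K| + 1)) _)) ?divr_gt0// mulrA ler_pdivrMr//.
by rewrite mulrC ler_wpM2l ?(ltW e0)// (le_trans (ler_norm _))// lerDl.
Qed.

Lemma rdist_small V (x y : V) (K : R) :
  (forall e : R, 0 < e -> rnorm (x - y) <= K * e) -> x = y.
Proof. by move=> /rnorm_small/subr0_eq. Qed.

(** Continuity guarantees that a value exists, so the chosen integral is a genuine one and not the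
    default 0. *)
Lemma bochner_integral_wsum V (f : G -> V) (T : finType) (idx : G -> T) (v : T -> V) (e : R) :
  continuous f -> mindex idx -> (forall h, rnorm (f h - v (idx h)) <= e) ->
  rnorm (I f - wsum mu idx v) <= e.
Proof.
move=> cf; apply: bochner_wsum.
have [x fx] := bochner_integrable mu compactG cf.
exact: (xgetPex 0 (ex_intro _ x fx)).
Qed.

Lemma oscillation_partition2 V W (f : G -> V) (k : G -> W) (e : R) : 0 < e ->
  continuous f -> continuous k ->
  exists (T : finType) (idx : G -> T) (pt : T -> G), [/\ mindex idx,
    forall h, rnorm (f h - f (pt (idx h))) <= e &
    forall h, rnorm (k h - k (pt (idx h))) <= e].
Proof.
move=> e0 /continuous_rnormP cf /continuous_rnormP ck.
have [|T [idx [pt [midx fk]]]] := fine_partition compactG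
    (U := fun g => [set h | rnorm (f h - f g) < e /\ rnorm (k h - k g) < e]).
  by move=> g; apply: filterI; [exact: cf | exact: ck].
by exists T, idx, pt; split=> // h; have [/ltW ? /ltW ?] := fk h.
Qed.

Lemma oscillation_partition V (f : G -> V) (e : R) : 0 < e -> continuous f ->
  exists (T : finType) (idx : G -> T) (pt : T -> G), mindex idx /\
    forall h, rnorm (f h - f (pt (idx h))) <= e.
Proof.
move=> e0 cf; have [T [idx [pt [midx h _]]]] := oscillation_partition2 e0 cf cf.
by exists T, idx, pt.
Qed.

Lemma bounded_additive_continuous (X : topologicalType) V W (L : V -> W) (C : R)
    (f : X -> V) :
  (forall a b, L (a + b) = L a + L b) -> (forall a, rnorm (L a) <= C * rnorm a) ->
  continuous f -> continuous (L \o f).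
Proof.
move=> LD LC cf x; apply/cvg_rnormP => e e0.
have L0 : L 0 = 0 by apply: (addrI (L 0)); rewrite -LD !addr0.
have LB a b : L (a - b) = L a - L b.
  by rewrite LD; congr (_ + _); apply: (addrI (L b)); rewrite -LD !subrr L0.
have C0 : 0 < `|C| + 1 by rewrite ltr_wpDl.
move/cvg_rnormP : (cf x) => /(_ (e / (`|C| + 1))); rewrite divr_gt0// => /(_ isT).
apply: filterS => y fyx; rewrite /= -LB (le_lt_trans (LC _))//.
rewrite (@le_lt_trans _ _ ((`|C| + 1) * rnorm (f y - f x)))//.
  by rewrite ler_wpM2r// (le_trans (ler_norm _))// lerDl.
by rewrite mulrC -ltr_pdivlMr.
Qed.

(** A bounded real-linear map sends partition sums to partition sums. Real homogeneity is the right
    generality: it covers the conjugate-linear [star] and the real part. *)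
Lemma bochner_map V W (L : V -> W) (C : R) (f : G -> V) :
  (forall a b, L (a + b) = L a + L b) ->
  (forall (r : R) a, L (r%:C *: a) = r%:C *: L a) ->
  (forall a, rnorm (L a) <= C * rnorm a) ->
  continuous f -> I (L \o f) = L (I f).
Proof.
move=> LD LZ LC cf.
have L0 : L 0 = 0 by apply: (addrI (L 0)); rewrite -LD !addr0.
have LB a b : L (a - b) = L a - L b.
  by rewrite LD; congr (_ + _); apply: (addrI (L b)); rewrite -LD !subrr L0.
have C0 : 0 <= `|C| by [].
have LC' a : rnorm (L a) <= `|C| * rnorm a.
  by rewrite (le_trans (LC a))// ler_wpM2r// ler_norm.
apply: (@rdist_small _ _ _ (`|C| * 2)) => e e0.
have [T [idx [pt [midx fe]]]] := oscillation_partition e0 cf.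
have h1 : rnorm (I (L \o f) - wsum mu idx (L \o f \o pt)) <= `|C| * e.
  apply: bochner_integral_wsum => //; first exact: bounded_additive_continuous LD LC cf.
  move=> h; rewrite /= -LB (le_trans (LC' _))//.
  by apply: ler_wpM2l => //; exact: fe.
have h2 : rnorm (L (I f) - wsum mu idx (L \o f \o pt)) <= `|C| * e.
  have -> : wsum mu idx (L \o f \o pt) = L (wsum mu idx (f \o pt)).
    rewrite /wsum (big_morph L LD L0); apply: eq_bigr => t _; exact/esym/LZ.
  rewrite -LB (le_trans (LC' _))// ler_wpM2l//; exact: bochner_integral_wsum.
have := rdistD (wsum mu idx (L \o f \o pt)) (I (L \o f)) (L (I f)).
rewrite rdistC in h2; lra.
Qed.

Lemma bochnerD V (f k : G -> V) : continuous f -> continuous k ->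
  I (fun h => f h + k h) = I f + I k.
Proof.
move=> cf ck; apply: (@rdist_small _ _ _ 4) => e e0.
have [T [idx [pt [midx fe ke]]]] := oscillation_partition2 e0 cf ck.
have h1 := bochner_integral_wsum (v := f \o pt) cf midx fe.
have h2 := bochner_integral_wsum (v := k \o pt) ck midx ke.
have := @bochner_integral_wsum _ _ _ idx (fun t => f (pt t) + k (pt t)) (2 * e)
  (continuous_addr cf ck) midx.
have -> : wsum mu idx (fun t => f (pt t) + k (pt t)) =
    wsum mu idx (f \o pt) + wsum mu idx (k \o pt).
  by rewrite /wsum -big_split; apply: eq_bigr => t _; rewrite scalerDr.
move=> h3; have {}h3 := h3 _.
have {}h3 : rnorm (I (fun h => f h + k h) -
    (wsum mu idx (f \o pt) + wsum mu idx (k \o pt))) <= 2 * e.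
  apply: h3 => h; rewrite opprD addrACA mulr_natl mulr2n.
  by rewrite (le_trans (rnormD _ _))// lerD ?fe ?ke.
have := rdistD (wsum mu idx (f \o pt) + wsum mu idx (k \o pt)) (I (fun h => f h + k h)) (I f + I k).
have subrACA (a b c d : V) : a + b - (c + d) = (a - c) + (b - d).
  by rewrite opprD addrACA.
rewrite [wsum mu idx (f \o pt) + wsum mu idx (k \o pt) - _]subrACA.
move/le_trans; apply; have -> : 4 * e = 2 * e + (e + e) by ring.
by rewrite lerD// (le_trans (rnormD _ _))// lerD// rdistC.
Qed.

Lemma bochnerZ V (c : R[i]) (f : G -> V) : continuous f ->
  I (fun h => c *: f h) = c *: I f.
Proof.
apply: (bochner_map (L := fun a => c *: a) (C := rnorm (c : R[i]^o))).
- by move=> a b; rewrite scalerDr.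
- by move=> r a; rewrite !scalerA mulrC.
- by move=> a; rewrite rnormZ.
Qed.

Lemma bochnerB V (f k : G -> V) : continuous f -> continuous k ->
  I (fun h => f h - k h) = I f - I k.
Proof.
move=> cf ck; have cNk : continuous (fun h => - k h).
  by move=> x; apply: cvgN; exact: ck.
rewrite bochnerD//; congr (_ + _).
have := bochnerZ (-1) ck; rewrite scaleN1r => <-.
by congr (bochner_integral mu _); apply/funext => h; rewrite scaleN1r.
Qed.

Lemma bochner_sum V (J : Type) (s : seq J) (c : J -> R[i]) (f : J -> G -> V) :
  (forall j, continuous (f j)) ->
  continuous (fun h => \sum_(j <- s) c j *: f j h) /\
  I (fun h => \sum_(j <- s) c j *: f j h) = \sum_(j <- s) c j *: I (f j).
Proof.
move=> cf.
have I0 : I (fun=> 0 : V) = 0.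
  transitivity (I (fun=> 0 - 0 : V)).
    by congr (bochner_integral mu _); apply/funext => h; rewrite subrr.
  by rewrite (bochnerB (@continuous_const G V 0) (@continuous_const G V 0)) subrr.
elim: s => [|j s [ih1 ih2]].
  split; first by under eq_fun do rewrite big_nil; exact: continuous_const.
  by rewrite big_nil -[RHS]I0; congr (bochner_integral mu _); apply/funext => h; rewrite big_nil.
have cj : continuous (fun h => c j *: f j h).
  by move=> x; apply: cvgZr; exact: cf.
have -> : (fun h => \sum_(j0 <- j :: s) c j0 *: f j0 h) =
   (fun h => c j *: f j h + \sum_(j0 <- s) c j0 *: f j0 h).
  by apply/funext => h; rewrite big_cons.
split; first exact: continuous_addr.
by rewrite big_cons bochnerD// bochnerZ// ih2.
Qed.

Lemma bochner_bound V (f : G -> V) (K : R) : continuous f ->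
  (forall h, rnorm (f h) <= K) -> rnorm (I f) <= K.
Proof.
move=> cf fK; apply/ler_addgt0Pl => e e0.
have [T [idx [pt [midx fe]]]] := oscillation_partition e0 cf.
have h1 := bochner_integral_wsum (v := f \o pt) cf midx fe.
rewrite -[I f](subrK (wsum mu idx (f \o pt))) (le_trans (rnormD _ _))// lerD//.
have -> : wsum mu idx (f \o pt) = wsum mu idx (f \o pt) - wsum mu idx (fun=> 0 : V).
  by rewrite /wsum [X in _ - X]big1 ?subr0// => t _; rewrite scaler0.
by apply: wsum_dist_le => // h; rewrite subr0; exact: fK.
Qed.

Lemma bochner_cst V (a : V) : I (fun=> a) = a.
Proof.
apply: (@rdist_small _ _ _ 1) => e e0; rewrite mul1r.
have [T [idx [pt [midx fe]]]] := oscillation_partition e0 (@continuous_const G V a).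
have := bochner_integral_wsum (v := fun=> a) (@continuous_const G V a) midx fe.
suff -> : wsum mu idx (fun=> a) = a by [].
by rewrite /wsum -scaler_suml -rmorph_sum sum_mass// scale1r.
Qed.

Lemma bochner_closed_cone V (P : V -> Prop) (f : G -> V) :
  P 0 -> (forall a b, P a -> P b -> P (a + b)) ->
  (forall (r : R) a, 0 <= r -> P a -> P (r%:C *: a)) ->
  (forall a, (forall e : R, 0 < e -> exists2 b, P b & rnorm (a - b) <= e) -> P a) ->
  continuous f -> (forall h, P (f h)) -> P (I f).
Proof.
move=> P0 PD PZ Pcl cf Pf; apply: Pcl => e e0.
have [T [idx [pt [midx fe]]]] := oscillation_partition e0 cf.
exists (wsum mu idx (f \o pt)); last exact: bochner_integral_wsum.
apply: (big_ind P) => // t _; by apply: PZ; [exact: mass_ge0 | exact: Pf].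
Qed.

Lemma bochner_real (f : G -> R) : continuous (fun h => (f h)%:C : scalars R) ->
  I (fun h => (f h)%:C : scalars R) =
    (complex.Re (I (fun h => (f h)%:C : scalars R)))%:C.
Proof.
move=> cf.
pose L (z : scalars R) : scalars R := (complex.Re z)%:C.
have LD a b : L (a + b) = L a + L b.
  by rewrite /L; case: a b => [? ?] [? ?]; exact: rmorphD.
have LZ (r : R) a : L (r%:C *: a) = r%:C *: L a.
  case: a => a b; rewrite /L -[RHS]/((r%:C * a%:C) : R[i]) -rmorphM; congr (_%:C).
  by rewrite -[LHS]/(r * a - 0 * b) mul0r subr0.
have LN a : rnorm (L a) <= 1 * rnorm a.
  by rewrite mul1r (le_trans _ (rnorm_Re a))//; rewrite (rnorm_real (complex.Re a)).
exact: (bochner_map LD LZ LN cf).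
Qed.

Lemma bochner_dominated V (f : G -> V) (k : G -> R) : continuous f ->
  continuous (fun h => (k h)%:C : scalars R) -> (forall h, rnorm (f h) <= k h) ->
  rnorm (I f) <= complex.Re (I (fun h => (k h)%:C : scalars R)).
Proof.
move=> cf ck fk; apply/ler_addgt0Pl => e e0.
have e20 : 0 < e / 2 by rewrite divr_gt0.
have [T [idx [pt [midx fe ke]]]] := oscillation_partition2 e20 cf ck.
have h1 := bochner_integral_wsum (v := f \o pt) cf midx fe.
have := bochner_integral_wsum (v := fun t => (k (pt t))%:C : scalars R) ck midx ke.
have -> : wsum mu idx (fun t => (k (pt t))%:C : scalars R) =
    (\sum_t mass mu (idx @^-1` [set t]) * k (pt t))%:C.
  by rewrite /wsum rmorph_sum; apply: eq_bigr => t _; rewrite rmorphM.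
rewrite bochner_real// -rmorphB rnorm_real ler_norml => /andP[h2 _].
have : rnorm (wsum mu idx (f \o pt)) <= \sum_t mass mu (idx @^-1` [set t]) * k (pt t).
  rewrite (le_trans (rnorm_sum _ _))//; apply: ler_sum => t _.
  by rewrite rnormZr ger0_norm ?mass_ge0// ler_wpM2l ?mass_ge0//; exact: fk.
have := rnormD (I f - wsum mu idx (f \o pt)) (wsum mu idx (f \o pt)).
rewrite subrK; move: h1 h2; lra.
Qed.

Section Haar.
Hypothesis haar : normalized_haar mu.

(** Translating the partition keeps the sample values and, by invariance, the masses of the cells;
    both integrals are close to the same sum. *)
Lemma bochner_translate V (f : G -> V) (g : G) : continuous f ->
  I (fun h => f (g * h)%g) = I f.
Proof.
move=> cf; apply: (@rdist_small _ _ _ 2) => e e0.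
have cmul_l : continuous (fun h : G => (g * h)%g).
  move=> h; apply: (@continuous_comp _ _ _ (fun h => (g, h)) (fun x : G * G => (x.1 * x.2)%g)).
    by apply: cvg_pair; [exact: cvg_cst | exact: cvg_id].
  exact: mulg_continuous.
have cg : continuous (fun h => f (g * h)%g).
  move=> h; apply: (@continuous_comp _ _ _ (fun h => (g * h)%g) f); last exact: cf.
  exact: cmul_l.
have [T [idx [pt [midx fe]]]] := oscillation_partition e0 cf.
have mg t : mass mu ((fun h => idx (g * h)%g) @^-1` [set t]) = mass mu (idx @^-1` [set t]).
  by rewrite /mass -(haar g (midx t)).
have midx' : mindex (fun h => idx (g * h)%g).
  move=> t; pose m (h : borel G) : borel G := (g * h)%g.
  have mm : measurable_fun setT m.
    apply: (@measurability _ _ _ _ setT m (@open G)) => // _ [U oU <-].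
    rewrite setTI; apply: sub_sigma_algebra.
    by apply: open_comp => // h _; exact: cmul_l.
  by have := mm measurableT _ (midx t); rewrite setTI.
have h1 := bochner_integral_wsum (v := f \o pt) cf midx fe.
have h2 := bochner_integral_wsum (v := f \o pt) cg midx' (fun h => fe (g * h)%g).
have eqw : wsum mu (fun h => idx (g * h)%g) (f \o pt) = wsum mu idx (f \o pt).
  by apply: eq_bigr => t _; rewrite mg.
have := rdistD (wsum mu idx (f \o pt)) (I (fun h => f (g * h)%g)) (I f).
rewrite rdistC in h1; rewrite eqw in h2; lra.
Qed.

End Haar.

(** Joint continuity is uniform in the second variable by compactness, in the style of the tube
    lemma. *)
Lemma tube V (F : G -> G -> V) (g : G) (e : R) : 0 < e ->
  continuous (fun x : G * G => F x.1 x.2) ->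
  \forall g' \near g, forall h, rnorm (F g' h - F g h) < e.
Proof.
move=> e0 cF; have e20 : 0 < e / 2 by rewrite divr_gt0.
have /compact_near_coveringP/(_ G (nbhs g) (fun g' h => rnorm (F g' h - F g h) < e)) := compactG.
have Hn : forall x : G, [set: G] x ->
    \forall x' \near x & i \near nbhs g, rnorm (F i x' - F g x') < e.
  move=> h _; move/cvg_rnormP : (cF (g, h)) => /(_ _ e20) [[U1 U2] /= [nU1 nU2] U].
  exists (U2, U1) => //= -[h' g'] /= [Uh' Ug'].
  have := U (g', h') (conj Ug' Uh'); have := U (g, h') (conj (nbhs_singleton nU1) Uh').
  move=> /= h1 h2; have := rdistD (F g h) (F g' h') (F g h').
  rewrite rdistC in h1; lra.
move=> /(_ _ Hn); apply: filterS => g' Hg' h; exact: Hg'.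
Qed.

Lemma continuous_slice V (F : G -> G -> V) (g : G) :
  continuous (fun x : G * G => F x.1 x.2) -> continuous (F g).
Proof.
move=> cF h; apply: (@continuous_comp _ _ _ (fun h => (g, h)) (fun x : G * G => F x.1 x.2)).
  by apply: cvg_pair; [exact: cvg_cst | exact: cvg_id].
exact: cF.
Qed.

Lemma continuous_integral V (F : G -> G -> V) :
  continuous (fun x : G * G => F x.1 x.2) -> continuous (fun g => I (F g)).
Proof.
move=> cF g; apply/cvg_rnormP => e e0; have e20 : 0 < e / 2 by rewrite divr_gt0.
apply: filterS (tube g e20 cF) => g' Fg'.
have cs g0 : continuous (F g0) by exact: continuous_slice.
rewrite -bochnerB//; apply: (@le_lt_trans _ _ (e / 2)); last by lra.
apply: bochner_bound => [|h]; last exact/ltW/Fg'.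
by move=> h; apply: cvgB; exact: cs.
Qed.

Lemma continuous_swap V (F : G -> G -> V) :
  continuous (fun x : G * G => F x.1 x.2) -> continuous (fun x : G * G => F x.2 x.1).
Proof.
move=> cF x.
apply: (@continuous_comp _ _ _ (fun x => (x.2, x.1)) (fun x : G * G => F x.1 x.2)).
  by apply: cvg_pair; [exact: cvg_snd | exact: cvg_fst].
exact: cF.
Qed.

(* Slicing only the first variable suffices: a partition on which F oscillates
   by at most e, uniformly in h, reduces both sides to the same finite sum. *)
Lemma bochner_fubini V (F : G -> G -> V) :
  continuous (fun x : G * G => F x.1 x.2) ->
  I (fun g => I (F g)) = I (fun h => I (fun g => F g h)).
Proof.
move=> cF; apply: (@rdist_small _ _ _ 2) => e e0.
have cs g0 : continuous (F g0) by exact: continuous_slice.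
have cs' h : continuous (fun g => F g h).
  exact: (@continuous_slice V (fun h g => F g h) h (continuous_swap cF)).
have [|T [idx [pt [midx Fe]]]] := fine_partition compactG
    (U := fun g => [set g' | forall h, rnorm (F g' h - F g h) < e]).
  by move=> g; exact: tube.
have c1 := continuous_integral cF.
have c2 := @continuous_integral V (fun h g => F g h) (continuous_swap cF).
have h1 : rnorm (I (fun g => I (F g)) - wsum mu idx (fun t => I (F (pt t)))) <= e.
  apply: bochner_integral_wsum => // g; rewrite -bochnerB//.
  apply: bochner_bound => [|h]; last exact/ltW/Fe.
  by move=> h; apply: cvgB; exact: cs.
have [cS IS] := @bochner_sum V T (index_enum T)
  (fun t => (mass mu (idx @^-1` [set t]))%:C) (fun t => F (pt t)) (fun t => cs (pt t)).
have h2 : rnorm (I (fun h => I (fun g => F g h)) - wsum mu idx (fun t => I (F (pt t)))) <= e.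
  rewrite /wsum -IS -bochnerB//.
  apply: bochner_bound => [h|h]; first by apply: cvgB; [exact: c2 | exact: cS].
  by apply: (bochner_integral_wsum (cs' h) midx) => g; exact/ltW/Fe.
have := rdistD (wsum mu idx (fun t => I (F (pt t)))) (I (fun g => I (F g)))
   (I (fun h => I (fun g => F g h))).
rewrite rdistC in h2; lra.
Qed.

End IntegralTheory.

(** * The convolution algebra *)

Section ContinuityRules.
Variables (R : realType) (G : topologicalGroupType) (A : cstarAlgType R).
Implicit Types X : topologicalType.

Lemma continuous_cmul X (f k : X -> A) : continuous f -> continuous k ->
  continuous (fun x => cmul (f x) (k x)).
Proof.
move=> cf ck x; apply/cvg_rnormP => e e0.
pose C := rnorm (f x) + rnorm (k x) + 1.
have C0 : 0 < C by rewrite ltr_wpDl// addr_ge0.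
pose d := Num.min 1 (e / C); have d0 : 0 < d by rewrite lt_min ltr01 divr_gt0.
move/cvg_rnormP : (cf x) => /(_ _ d0); move/cvg_rnormP : (ck x) => /(_ _ d0).
apply: filterS2 => y ky fy.
have -> : cmul (f y) (k y) - cmul (f x) (k x) =
    cmul (f y) (k y - k x) + cmul (f y - f x) (k x).
  by rewrite cmulBr cmulBl addrA subrK.
have fyle : rnorm (f y) <= rnorm (f x) + 1.
  have := rnormD (f y - f x) (f x); rewrite subrK => /le_trans; apply.
  rewrite addrC lerD2l.
  by rewrite (le_trans (ltW fy))// /d ge_min lexx.
have dC : d * C <= e by rewrite -ler_pdivlMr// /d ge_min lexx orbT.
have h1 := rnorm_cmul (f y) (k y - k x); have h2 := rnorm_cmul (f y - f x) (k x).
have h3 : rnorm (f y) * rnorm (k y - k x) <= (rnorm (f x) + 1) * rnorm (k y - k x).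
  by rewrite ler_wpM2r.
have h4 : (rnorm (f x) + 1) * rnorm (k y - k x) < (rnorm (f x) + 1) * d.
  by rewrite ltr_pM2l// ltr_wpDl.
have h5 : rnorm (f y - f x) * rnorm (k x) <= d * rnorm (k x) by rewrite ler_wpM2r// ltW.
apply: le_lt_trans (rnormD _ _) _.
apply: le_lt_trans (lerD h1 h2) _.
apply: le_lt_trans (lerD h3 h5) _.
apply: lt_le_trans dC.
have -> : d * C = (rnorm (f x) + 1) * d + d * rnorm (k x) by rewrite /C; ring.
by rewrite ltrD2r.
Qed.

Lemma continuous_star X (f : X -> A) : continuous f -> continuous (fun x => star (f x)).
Proof.
apply: (@bounded_additive_continuous R X A A (@star R A) 1); first exact: starD.
by move=> a; rewrite mul1r rnorm_star.
Qed.

Lemma continuous_comp_fun X (f : G -> A) (p : X -> G) : continuous f -> continuous p ->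
  continuous (fun x => f (p x)).
Proof. by move=> cf cp x; apply: (@continuous_comp _ _ _ p f); [exact: cp | exact: cf]. Qed.

Lemma continuous_mulg X (p q : X -> G) : continuous p -> continuous q ->
  continuous (fun x => (p x * q x)%g).
Proof.
move=> cp cq x.
apply: (@continuous_comp _ _ _ (fun x => (p x, q x)) (fun x : G * G => (x.1 * x.2)%g)).
  by apply: cvg_pair; [exact: cp | exact: cq].
exact: mulg_continuous.
Qed.

Lemma continuous_invg X (p : X -> G) : continuous p -> continuous (fun x => (p x)^-1%g).
Proof.
move=> cp x; apply: (@continuous_comp _ _ _ p (fun x : G => x^-1%g)); first exact: cp.
exact: invg_continuous.
Qed.

Lemma continuous_idfun X : continuous (fun x : X => x).
Proof. by move=> x; exact: cvg_id. Qed.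

Lemma continuous_fst X (Y : topologicalType) : continuous (fun x : X * Y => x.1).
Proof. by move=> x; exact: cvg_fst. Qed.

Lemma continuous_snd X (Y : topologicalType) : continuous (fun x : X * Y => x.2).
Proof. by move=> x; exact: cvg_snd. Qed.

Lemma continuous_scaler X (c : R[i]) (f : X -> A) : continuous f ->
  continuous (fun x => c *: f x).
Proof. by move=> cf x; apply: cvgZr; exact: cf. Qed.

Lemma continuous_subr X (f k : X -> A) : continuous f -> continuous k ->
  continuous (fun x => f x - k x).
Proof. by move=> cf ck x; apply: cvgB; [exact: cf | exact: ck]. Qed.

Variable alpha : G -> A -> A.
Hypothesis act : continuous_action alpha.

Lemma alpha0 g : alpha g 0 = 0.
Proof. by apply: (addrI (alpha g 0)); rewrite -(actionD act) !addr0. Qed.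

Lemma alphaB g a b : alpha g (a - b) = alpha g a - alpha g b.
Proof. by rewrite (actionD act) -scaleN1r (actionZ act) scaleN1r. Qed.

Lemma alphaK g a : alpha g (alpha g^-1%g a) = a.
Proof. by rewrite -(actionM act) mulgV (action1 act). Qed.

(** Continuity at 0 for the uniform topology yields a ball of radius [d] on which every [alpha g] is
    bounded by 1; rescaling to norm [d / 2] gives [2 / d]. *)
Lemma action_bounded : exists2 M : R, 0 < M & forall g a, rnorm (alpha g a) <= M * rnorm a.
Proof.
have [d d0 dP] : exists2 d : R, 0 < d &
    forall a, rnorm a < d -> forall g, rnorm (alpha g a) <= 1.
  pose P : set {uniform G -> A} := [set f | forall g, rnorm (f g) <= 1].
  have nP : nbhs (alpha^~ 0 : {uniform G -> A}) P.
    apply/uniform_nbhs; exists [set xy | ball xy.1 (1 : R[i]) xy.2]; split.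
      by rewrite -entourage_ballE; exists 1 => /=.
    move=> f /= fP g; have := fP g Logic.I; rewrite alpha0 -ball_normE /=.
    by rewrite sub0r normrN rnormE -[1]/(1%:C) ltcR => /ltW.
  have /nbhs_ballP[e /= /gt0_complexE[eE e0] eP] :
    nbhs (0 : A) [set a | P (alpha^~ a)] by exact: (action_continuous act nP).
  exists (complex.Re e) => // a ae g; apply: eP.
  by rewrite -ball_normE /= sub0r normrN rnormE eE ltcR.
exists (2 / d) => [|g a]; first by rewrite divr_gt0.
have [->|a0] := eqVneq a 0; first by rewrite alpha0 rnorm0 mulr0.
have a0' : 0 < rnorm a by rewrite rnorm_gt0.
pose r := d / (2 * rnorm a); have r0 : 0 < r by rewrite divr_gt0// mulr_gt0.
have := dP (r%:C *: a); rewrite rnormZr gtr0_norm//.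
have -> : r * rnorm a = d / 2 by rewrite /r; field; rewrite gt_eqF.
have d2 : d / 2 < d by lra.
move=> /(_ d2 g); rewrite (actionZ act) rnormZr gtr0_norm//.
rewrite -ler_pdivlMl// mulr1 => /le_trans; apply.
by rewrite /r invf_div [leRHS]mulrAC.
Qed.

(** The uniform bound [M] handles the change of the vector, continuity of orbits the change of the
    group element. *)
Lemma continuous_alpha X (p : X -> G) (f : X -> A) : continuous p -> continuous f ->
  continuous (fun x => alpha (p x) (f x)).
Proof.
move=> cp cf x; apply/cvg_rnormP => e e0; have [M M0 MP] := action_bounded.
have e20 : 0 < e / 2 by rewrite divr_gt0.
have eM0 : 0 < e / 2 / M by rewrite divr_gt0.
move/cvg_rnormP : (cf x) => /(_ _ eM0) H1.
have /cvg_rnormP/(_ _ e20) H2 : (alpha^~ (f x)) (p y) @[y --> x] --> alpha (p x) (f x).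
  apply: (@continuous_comp _ _ _ p (alpha^~ (f x))); first exact: cp.
  exact: action_orbit_continuous.
apply: filterS2 H1 H2 => y h1 h2.
have h3 := MP (p y) (f y - f x); rewrite alphaB in h3.
have h4 : M * rnorm (f y - f x) < e / 2 by rewrite mulrC -ltr_pdivlMr.
have h5 := rdistD (alpha (p y) (f x)) (alpha (p y) (f y)) (alpha (p x) (f x)).
by rewrite (le_lt_trans h5)// [ltRHS]splitr ltrD// (le_lt_trans h3).
Qed.

End ContinuityRules.

(** The general pattern for the action would also match the binary operations, so it is tried after
    them. *)
Ltac continuity act :=
  repeat match goal with
  | |- continuous (fun x => cmul (@?f x) (@?k x)) => apply: continuous_cmul
  | |- continuous (fun x => star (@?f x)) => apply: continuous_star
  | |- continuous (fun x => (@?f x) + - (@?k x)) => apply: continuous_subr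
  | |- continuous (fun x => (@?f x) + (@?k x)) => apply: continuous_addr
  | |- continuous (fun x => ?c *: (@?f x)) => apply: continuous_scaler
  | |- continuous (fun x => (@?p x * @?q x)%g) => apply: continuous_mulg
  | |- continuous (fun x => ((@?p x)^-1)%g) => apply: continuous_invg
  | |- continuous (fun x => x.1) => exact: continuous_fst
  | |- continuous (fun x => x.2) => exact: continuous_snd
  | |- continuous fst => exact: continuous_fst
  | |- continuous snd => exact: continuous_snd
  | |- continuous (fun x => x) => apply: continuous_idfun
  | H : continuous ?f |- continuous ?f => exact: H
  | |- continuous (fun x => ?a) => apply: continuous_const
  | |- continuous (fun x => ?al (@?p x) (@?f x)) => apply: (continuous_alpha act)
  | H : continuous ?f |- continuous (fun x => ?f (@?p x)) =>
      apply: (@continuous_comp_fun _ _ _ _ f p)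
  | |- continuous _ => exact: invg_continuous
  | |- continuous ( *%g ?h) =>
      exact: (continuous_mulg (@continuous_const _ _ h) (@continuous_idfun _))
  end.

Section Convolution.
Variables (R : realType) (G : topologicalGroupType) (A : cstarAlgType R).
Variables (mu : probability (borel G) R) (alpha : G -> A -> A).
Hypothesis compactG : compact [set: G].
Hypothesis haar : normalized_haar mu.
Hypothesis act : continuous_action alpha.
Local Notation I f := (bochner_integral mu f).
Local Notation conv := (convolution mu alpha).
Local Notation inv := (involution alpha).
Implicit Types (f x y : G -> A) (a b : A).

Lemma bochner_cmull a f : continuous f -> I (fun h => cmul a (f h)) = cmul a (I f).
Proof.
apply: (@bochner_map R G mu compactG A A (cmul a) (rnorm a)) => [b c|r b|b].
- exact: cmulDr.
- exact: cmulZr.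
- exact: rnorm_cmul.
Qed.

Lemma bochner_cmulr a f : continuous f -> I (fun h => cmul (f h) a) = cmul (I f) a.
Proof.
apply: (@bochner_map R G mu compactG A A (fun b => cmul b a) (rnorm a)) => [b c|r b|b].
- exact: cmulDl.
- exact: cmulZl.
- by rewrite mulrC; exact: rnorm_cmul.
Qed.

Lemma bochner_star f : continuous f -> I (fun h => star (f h)) = star (I f).
Proof.
apply: (@bochner_map R G mu compactG A A (@star R A) 1) => [b c|r b|b].
- exact: starD.
- by rewrite starZ conjc_real.
- by rewrite mul1r rnorm_star.
Qed.

Lemma bochner_alpha g f : continuous f -> I (fun h => alpha g (f h)) = alpha g (I f).
Proof.
have [M _ MP] := action_bounded act.
apply: (@bochner_map R G mu compactG A A (alpha g) M) => [b c|r b|b].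
- exact: actionD.
- exact: actionZ.
- exact: MP.
Qed.

Lemma continuous_conv f k : continuous f -> continuous k -> continuous (conv f k).
Proof.
move=> cf ck.
apply: (@continuous_integral R G mu compactG A
  (fun g h => cmul (f h) (alpha h (k (h^-1 * g)%g)))).
continuity act.
Qed.

Lemma continuous_inv f : continuous f -> continuous (inv f).
Proof. by move=> cf; rewrite /involution; continuity act. Qed.

Lemma invfK f : inv (inv f) = f.
Proof.
apply/funext => g; rewrite /involution invgK (action_star act).
by rewrite alphaK// starK.
Qed.

(** Both sides are double integrals of [F]: left translation by [h] aligns the inner variable, and
    Fubini exchanges the order. *)
Lemma conv_assoc f1 f2 f3 : continuous f1 -> continuous f2 -> continuous f3 ->
  conv f1 (conv f2 f3) = conv (conv f1 f2) f3.
Proof.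
move=> c1 c2 c3; apply/funext => g.
pose F h k := cmul (cmul (f1 h) (alpha h (f2 (h^-1 * k)%g))) (alpha k (f3 (k^-1 * g)%g)).
have cF : continuous (fun x : G * G => F x.1 x.2) by rewrite /F; continuity act.
transitivity (I (fun h => I (F h))).
  apply: eq_bochner => h.
  have cFh : continuous (F h) by rewrite /F; continuity act.
  rewrite -(bochner_translate compactG haar h cFh).
  rewrite -bochner_alpha; last by continuity act.
  rewrite -bochner_cmull; last by continuity act.
  apply: eq_bochner => k; rewrite /F mulKg (action_cmul act) cmulA.
  by rewrite (actionM act) invgM mulgA.
rewrite (bochner_fubini mu compactG cF); apply: eq_bochner => k.
by rewrite /F bochner_cmulr//; continuity act.
Qed.

Lemma inv_conv f k : continuous f -> continuous k -> inv (conv f k) = conv (inv k) (inv f).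
Proof.
move=> cf ck; apply/funext => g; rewrite /convolution /involution.
rewrite -bochner_star; last by continuity act.
rewrite -bochner_alpha; last by continuity act.
have cF : continuous (fun h => cmul (alpha h (star (k h^-1%g)))
    (alpha h (alpha (h^-1 * g)%g (star (f (h^-1 * g)^-1%g))))) by continuity act.
rewrite -(bochner_translate compactG haar g cF); apply: eq_bochner => h.
rewrite starM (action_cmul act) -(action_star act) -!(actionM act).
rewrite mulgA mulgV mul1g; congr (cmul _ (alpha g (star (f _)))); last first.
  by rewrite invgM invgK mulKg.
by rewrite invgM.
Qed.

(** Its adjoint at [h] is the involution of [x] at [h]. This turns the value at 1 of the convolution
    of the involution of [x] with [y] into a plain [A]-valued inner product of [twist x] and
    [twist y]. *)
Definition twist x h : A := alpha h (x h^-1%g).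

Definition ip x y : A := I (fun h => cmul (star (twist x h)) (twist y h)).

Lemma continuous_twist x : continuous x -> continuous (twist x).
Proof. by move=> cx; rewrite /twist; continuity act. Qed.

Lemma ipE x y : ip x y = conv (inv x) y 1%g.
Proof.
apply: eq_bochner => h; rewrite /involution /twist mulg1.
by rewrite (action_star act).
Qed.

Lemma ip_adjoint f x y : continuous f -> continuous x -> continuous y ->
  ip x (conv f y) = ip (conv (inv f) x) y.
Proof.
move=> cf cx cy; have cif := continuous_inv cf; have cix := continuous_inv cx.
by rewrite !ipE (inv_conv cif cx) invfK (conv_assoc cix cf cy).
Qed.

End Convolution.

(** * The regular representation *)

Section RegularRepresentation.
Variables (R : realType) (G : topologicalGroupType) (A : cstarAlgType R).
Variables (mu : probability (borel G) R) (alpha : G -> A -> A).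
Hypothesis compactG : compact [set: G].
Hypothesis haar : normalized_haar mu.
Hypothesis act : continuous_action alpha.
Local Notation I f := (bochner_integral mu f).
Local Notation conv := (convolution mu alpha).
Local Notation inv := (involution alpha).
Local Notation ip := (ip mu alpha).
Local Notation twist := (twist alpha).
Implicit Types (f x y : G -> A) (a b : A).

Lemma bochner_pos f : continuous f -> (forall h, pos (f h)) -> pos (I f).
Proof.
apply: (@bochner_closed_cone R G mu compactG A (@pos R A)).
- exact: pos0.
- exact: posD.
- exact: posZ.
- exact: pos_closed.
Qed.

(** Here [P], [a], [Q] stand for the inner products of [x] with [x], [x] with [y], [y] with [y], and
    the positive element is the square of [x a - N y]. Since [P] is below [N], the inequality
    collapses to [N a^* a <= N^2 Q]. *)
Lemma pos_square_completion (P Q a : A) (N : R) : 0 < N -> rnorm P <= N -> pos P ->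
  pos (cmul (star a) (cmul P a) - N%:C *: cmul (star a) a
       - (N%:C *: cmul (star a) a - N%:C *: (N%:C *: Q))) ->
  rnorm a ^+ 2 <= N * rnorm Q.
Proof.
move=> N0 PN pP pz; have p1 := pos_conj_norm a (pos_selfadj pP).
have p2 : pos ((N - rnorm P)%:C *: cmul (star a) a).
  by apply: posZ; [rewrite subr_ge0 | exact: pos_cstar].
have p3 : pos (N%:C *: (N%:C *: Q) - N%:C *: cmul (star a) a).
  have alg (t u v w : A) : t - u - (u - w) + (v - t + (u - v)) = w - u.
    have -> : v - t + (u - v) = u - t by rewrite addrC addrA subrK.
    by rewrite -[u - t]opprB addrAC subrr sub0r opprB.
  by have := posD pz (posD p1 p2); rewrite rmorphB scalerBl alg.
have p4 : pos (N%:C *: cmul (star a) a) by apply: posZ; [exact: ltW | exact: pos_cstar].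
have := pos_mono p4 p3.
by rewrite subrKC !rnormZr (gtr0_norm N0) rnorm_cstar (ler_pM2l N0).
Qed.

(** Requiring [N > 0] keeps division possible when [p = 0]; letting [N] decrease to [p] recovers the
    sharp bound. *)
Lemma ler_mul_inf (p q c : R) : 0 <= p -> 0 <= q ->
  (forall N, 0 < N -> p <= N -> c <= N * q) -> c <= p * q.
Proof.
move=> p0 q0 cN; apply/ler_addgt0Pl => e e0.
have q1 : 0 < q + 1 by rewrite ltr_wpDl.
pose d := e / (q + 1); have d0 : 0 < d by rewrite divr_gt0.
apply: le_trans (cN (p + d) _ _) _; [by rewrite ltr_wpDl | by rewrite lerDl ltW | ].
rewrite mulrDl addrC lerD2r /d mulrAC ler_pdivrMr//.
by rewrite ler_wpM2l ?(ltW e0)// lerDl.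
Qed.

Lemma bochner_square x y a (N : R) : continuous x -> continuous y ->
  I (fun h => cmul (star (cmul (x h) a - N%:C *: y h)) (cmul (x h) a - N%:C *: y h)) =
  cmul (star a) (cmul (I (fun h => cmul (star (x h)) (x h))) a)
  - N%:C *: cmul (star a) (I (fun h => cmul (star (x h)) (y h)))
  - (N%:C *: cmul (star (I (fun h => cmul (star (x h)) (y h)))) a
     - N%:C *: (N%:C *: I (fun h => cmul (star (y h)) (y h)))).
Proof.
move=> cx cy.
have cxx : continuous (fun h => cmul (star (x h)) (x h)) by continuity act.
have cxy : continuous (fun h => cmul (star (x h)) (y h)) by continuity act.
have cyx : continuous (fun h => cmul (star (y h)) (x h)) by continuity act.
have cyy : continuous (fun h => cmul (star (y h)) (y h)) by continuity act.
transitivity (I (fun h => cmul (star a) (cmul (cmul (star (x h)) (x h)) a)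
   - N%:C *: (cmul (star a) (cmul (star (x h)) (y h)))
   - (N%:C *: cmul (cmul (star (y h)) (x h)) a
      - N%:C *: (N%:C *: (cmul (star (y h)) (y h)))))).
  apply: eq_bochner => h; rewrite starB starM starZ conjc_real.
  by rewrite cmulBl !cmulBr !cmulZl !cmulZr !cmulA.
have yxE : I (fun h => cmul (star (y h)) (x h)) =
    star (I (fun h => cmul (star (x h)) (y h))).
  rewrite -(bochner_star mu compactG cxy); apply: eq_bochner => h.
  by rewrite starM starK.
rewrite (bochnerB mu compactG); [|by continuity act..].
rewrite (bochnerB mu compactG); [|by continuity act..].
rewrite (bochnerB mu compactG); [|by continuity act..].
rewrite !(bochnerZ mu compactG); [|by continuity act..].
rewrite !(bochner_cmull mu compactG); [|by continuity act..].
rewrite !(bochner_cmulr mu compactG); [|by continuity act..].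
by rewrite yxE.
Qed.

Lemma cauchy_schwarz x y : continuous x -> continuous y ->
  rnorm (I (fun h => cmul (star (x h)) (y h))) ^+ 2 <=
    rnorm (I (fun h => cmul (star (x h)) (x h))) *
    rnorm (I (fun h => cmul (star (y h)) (y h))).
Proof.
move=> cx cy; apply: ler_mul_inf => [||N N0 PN]; [exact: rnorm_ge0..|].
have cxx : continuous (fun h => cmul (star (x h)) (x h)) by continuity act.
have [a aE] : exists a, a = I (fun h => cmul (star (x h)) (y h)) by eexists.
have := bochner_square a N cx cy; rewrite -aE => E.
apply: (pos_square_completion N0 PN).
  by apply: (bochner_pos cxx) => h; exact: pos_cstar.
rewrite -E; apply: bochner_pos => [|h]; last exact: pos_cstar.
by continuity act.
Qed.

(* Sealed behind an opaque proof: unification would otherwise unfold the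
   integral. *)
Lemma norm2_spec :
  {n : (G -> A) -> R | forall x, 0 <= n x /\ n x ^+ 2 = rnorm (ip x x)}.
Proof.
exists (fun x => Num.sqrt (rnorm (ip x x))) => x.
by rewrite sqrtr_ge0 sqr_sqrtr.
Qed.

Definition norm2 : (G -> A) -> R := sval norm2_spec.

Lemma norm2_ge0 x : 0 <= norm2 x.
Proof. by have [] := svalP norm2_spec x. Qed.

Lemma norm2_sqr x : norm2 x ^+ 2 = rnorm (ip x x).
Proof. by have [] := svalP norm2_spec x. Qed.

Lemma norm2_le x (c : R) : 0 <= c -> rnorm (ip x x) <= c ^+ 2 -> norm2 x <= c.
Proof. by move=> c0; rewrite -norm2_sqr ler_pXn2r// nnegrE norm2_ge0. Qed.

Lemma ip_le x y : continuous x -> continuous y -> rnorm (ip x y) <= norm2 x * norm2 y.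
Proof.
move=> cx cy; rewrite -(@ler_pXn2r _ 2) ?nnegrE ?rnorm_ge0 ?mulr_ge0 ?norm2_ge0//.
have -> : (norm2 x * norm2 y) ^+ 2 = rnorm (ip x x) * rnorm (ip y y).
  by rewrite exprMn (norm2_sqr x) (norm2_sqr y).
exact: (cauchy_schwarz (continuous_twist act cx) (continuous_twist act cy)).
Qed.

Lemma twistD x y h : twist (fun g => x g + y g) h = twist x h + twist y h.
Proof. exact: (actionD act). Qed.

Lemma norm2D x y : continuous x -> continuous y ->
  norm2 (fun g => x g + y g) <= norm2 x + norm2 y.
Proof.
move=> cx cy.
have ctx := continuous_twist act cx; have cty := continuous_twist act cy.
rewrite -(@ler_pXn2r _ 2) ?nnegrE ?addr_ge0 ?norm2_ge0//.
rewrite norm2_sqr.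
have -> : ip (fun g => x g + y g) (fun g => x g + y g) = ip x x + ip x y + (ip y x + ip y y).
  pose z (u v : G -> A) h := cmul (star (twist u h)) (twist v h).
  have cz u v : continuous (twist u) -> continuous (twist v) -> continuous (z u v).
    by move=> cu cv; rewrite /z; continuity act.
  transitivity (I (fun h => (z x x h + z x y h) + (z y x h + z y y h))).
    by apply: eq_bochner => h; rewrite /z !twistD starD cmulDl !cmulDr.
  have c1 := continuous_addr (cz _ _ ctx ctx) (cz _ _ ctx cty).
  have c2 := continuous_addr (cz _ _ cty ctx) (cz _ _ cty cty).
  rewrite (bochnerD mu compactG c1 c2).
  rewrite (bochnerD mu compactG (cz _ _ ctx ctx) (cz _ _ ctx cty)).
  by rewrite (bochnerD mu compactG (cz _ _ cty ctx) (cz _ _ cty cty)).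
have h1 := ip_le cx cx; have h2 := ip_le cx cy; have h3 := ip_le cy cx; have h4 := ip_le cy cy.
have -> : (norm2 x + norm2 y) ^+ 2 =
  (norm2 x * norm2 x + norm2 x * norm2 y) + (norm2 y * norm2 x + norm2 y * norm2 y) by ring.
do 2 apply: le_trans (rnormD _ _) (lerD _ _) => //.
Qed.

Lemma norm2Z (c : R[i]) x : continuous x ->
  norm2 (fun g => c *: x g) = rnorm (c : R[i]^o) * norm2 x.
Proof.
move=> cx; have ctx := continuous_twist act cx.
apply/eqP; rewrite -(@eqrXn2 _ 2) ?mulr_ge0 ?norm2_ge0// exprMn !norm2_sqr.
have -> : ip (fun g => c *: x g) (fun g => c *: x g) = (conjc c * c) *: ip x x.
  rewrite -(bochnerZ mu compactG); last by continuity act.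
  apply: eq_bochner => h; rewrite /twist !(actionZ act) starZ cmulZl cmulZr.
  by rewrite scalerA.
by rewrite rnormZ rnormM rnorm_conjc expr2.
Qed.

Lemma bounded_range f : continuous f -> exists2 K : R, 0 <= K & forall h, rnorm (f h) <= K.
Proof.
move=> cf; have [T [idx [pt [midx fe]]]] := oscillation_partition compactG ltr01 cf.
exists (1 + \sum_t rnorm (f (pt t))).
  by rewrite addr_ge0// sumr_ge0// => t _; exact: rnorm_ge0.
move=> h; rewrite -[f h](subrK (f (pt (idx h)))) (le_trans (rnormD _ _))// lerD ?fe//.
by rewrite (bigD1 (idx h))//= lerDl sumr_ge0// => t _; exact: rnorm_ge0.
Qed.

(** Positivity of the variance: the integral of the square of [x - m], with [m] the mean, expands to
    this difference since the total mass is 1. *)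
Lemma jensen x : continuous x ->
  pos (I (fun h => cmul (star (x h)) (x h)) - cmul (star (I x)) (I x)).
Proof.
move=> cx; set m := I x.
have : pos (I (fun h => cmul (star (x h - m)) (x h - m))).
  by apply: bochner_pos => [|h]; [continuity act | exact: pos_cstar].
congr pos.
transitivity (I (fun h => (cmul (star (x h)) (x h) - cmul (star (x h)) m)
   - (cmul (star m) (x h) - cmul (star m) m))).
  by apply: eq_bochner => h; rewrite starB cmulBl !cmulBr.
rewrite (bochnerB mu compactG); [|by continuity act..].
rewrite (bochnerB mu compactG); [|by continuity act..].
rewrite (bochnerB mu compactG); [|by continuity act..].
rewrite (bochner_cmull mu compactG)// (bochner_cmulr mu compactG); last by continuity act.
by rewrite (bochner_star mu compactG)// (bochner_cst mu compactG) subrr subr0.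
Qed.

End RegularRepresentation.

(** * The operator norm of the regular representation as a C*-seminorm *)

Section RegularNorm.
Variables (R : realType) (G : topologicalGroupType) (A : cstarAlgType R).
Variables (mu : probability (borel G) R) (alpha : G -> A -> A).
Hypothesis compactG : compact [set: G].
Hypothesis haar : normalized_haar mu.
Hypothesis act : continuous_action alpha.
Local Notation I f := (bochner_integral mu f).
Local Notation conv := (convolution mu alpha).
Local Notation inv := (involution alpha).
Local Notation ip := (ip mu alpha).
Local Notation twist := (twist alpha).
Local Notation norm2 := (norm2 mu alpha).
Implicit Types (f x y : G -> A) (a b : A).

(** In this form the operator averages translates of [twist x] with uniformly bounded coefficients,
    which is what [jensen] can estimate. *)
Lemma twist_conv f x h : continuous f -> continuous x ->
  twist (conv f x) h = I (fun k => cmul (alpha h (f k)) (twist x (h * k)%g)).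
Proof.
move=> cf cx; rewrite /twist /convolution.
rewrite -(bochner_alpha mu compactG act); last by continuity act.
apply: eq_bochner => k; rewrite (action_cmul act) -(actionM act).
by rewrite invgM.
Qed.

Lemma pos_mul_bound b t (K : R) : rnorm b <= K ->
  pos ((K ^+ 2)%:C *: cmul (star t) t - cmul (star (cmul b t)) (cmul b t)).
Proof.
move=> bK; have sb : star (cmul (star b) b) = cmul (star b) b by rewrite starM starK.
have := pos_conj_norm t sb; rewrite rnorm_cstar => p1.
have p2 : pos ((K ^+ 2 - rnorm b ^+ 2)%:C *: cmul (star t) t).
  apply: posZ; last exact: pos_cstar.
  by rewrite subr_ge0 ler_pXn2r// nnegrE// (le_trans _ bK).
have := posD p2 p1; rewrite rmorphB scalerBl addrA subrK.
by rewrite starM !cmulA.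
Qed.

(* Jensen's inequality for the vector-valued integral defining conv f x. *)
Lemma norm2_conv f : continuous f -> exists2 K : R, 0 <= K &
  forall x, continuous x -> norm2 (conv f x) <= K * norm2 x.
Proof.
move=> cf; have [Kf Kf0 fK] := bounded_range compactG cf.
have [M M0 MP] := action_bounded act.
pose K := M * Kf; have K0 : 0 <= K by rewrite mulr_ge0// ltW.
have afK h k : rnorm (alpha h (f k)) <= K.
  by rewrite (le_trans (MP h (f k)))// ler_wpM2l ?(ltW M0) ?fK.
exists K => // x cx; have ctx := continuous_twist act cx.
have cy := continuous_conv (mu := mu) compactG act cf cx.
have cty := continuous_twist act cy.
pose s h := cmul (star (twist x h)) (twist x h).
have cs : continuous s by rewrite /s; continuity act.
pose r h := cmul (star (twist (conv f x) h)) (twist (conv f x) h).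
have cr : continuous r by rewrite /r; continuity act.
have ps : pos (I s) by apply: (bochner_pos mu compactG cs) => h; exact: pos_cstar.
have pr : pos (I r) by apply: (bochner_pos mu compactG cr) => h; exact: pos_cstar.
(* At fixed [h], Jensen and the coefficient bound [K] dominate the square by an average of
   [s (h * k)], and left invariance removes [h]. Integrating the resulting constant over [h] then
   costs nothing. *)
have point h : pos ((K ^+ 2)%:C *: I s - r h).
  pose w k := cmul (alpha h (f k)) (twist x (h * k)%g).
  have cw : continuous w by rewrite /w; continuity act.
  have csh : continuous (fun k => s (h * k)%g) by continuity act.
  have cKs : continuous (fun k => (K ^+ 2)%:C *: s (h * k)%g) by continuity act.
  have cww : continuous (fun k => cmul (star (w k)) (w k)) by continuity act.
  have p1 : pos (I (fun k => (K ^+ 2)%:C *: s (h * k)%g - cmul (star (w k)) (w k))).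
    apply: (bochner_pos mu compactG (continuous_subr cKs cww)) => k.
    exact: pos_mul_bound.
  rewrite (bochnerB mu compactG cKs cww) (bochnerZ mu compactG _ csh) in p1.
  rewrite (bochner_translate compactG haar h cs) in p1.
  have p2 := jensen mu compactG cw.
  have := posD p1 p2; rewrite addrA subrK.
  by rewrite /r (twist_conv h cf cx).
have pK : pos ((K ^+ 2)%:C *: I s - I r).
  have cc : continuous (fun _ : G => (K ^+ 2)%:C *: I s) by exact: continuous_const.
  have := bochner_pos mu compactG (continuous_subr cc cr) point.
  by rewrite (bochnerB mu compactG cc cr) (bochner_cst mu compactG).
apply: norm2_le; first by apply: mulr_ge0 => //; exact: norm2_ge0.
rewrite exprMn (norm2_sqr _ _ x).
by have := pos_mono pr pK; rewrite subrKC rnormZr (ger0_norm (sqr_ge0 K)).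
Qed.

(** The value at [g] is [alpha g] of an inner product of [twist x] with a function [u] bounded
    independently of [g], so Cauchy-Schwarz applies. One factor [M] comes from the outer [alpha g],
    the other from the action inside [u]. *)
Lemma conv_sup f : continuous f -> exists2 K : R, 0 <= K &
  forall x g, continuous x -> rnorm (conv f x g) <= K * norm2 x.
Proof.
move=> cf; have [Kf Kf0 fK] := bounded_range compactG cf.
have [M M0 MP] := action_bounded act; have M0' := ltW M0.
have K0 : 0 <= M * Kf by rewrite mulr_ge0.
exists (M * (M * Kf)); first by rewrite mulr_ge0.
move=> x g cx; have ctx := continuous_twist act cx.
pose u k := star (alpha g^-1%g (f (g * k)%g)).
have cu : continuous u by rewrite /u; continuity act.
have cux : continuous (fun k => cmul (star (u k)) (twist x k)) by continuity act.
have -> : conv f x g = alpha g (I (fun k => cmul (star (u k)) (twist x k))).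
  have cc : continuous (fun h => cmul (f h) (alpha h (x (h^-1 * g)%g))) by continuity act.
  rewrite /convolution -(bochner_translate compactG haar g cc).
  rewrite -(bochner_alpha mu compactG act _ cux).
  apply: eq_bochner => k; rewrite /u starK (action_cmul act) alphaK//.
  by rewrite /twist -(actionM act) invgM mulgVK.
rewrite (le_trans (MP _ _))// -mulrA ler_wpM2l//.
rewrite -(@ler_pXn2r _ 2) ?nnegrE ?mulr_ge0 ?norm2_ge0//.
apply: le_trans (cauchy_schwarz mu compactG cu ctx) _.
rewrite exprMn (norm2_sqr _ _ x) ler_wpM2r//.
have cuu : continuous (fun k => cmul (star (u k)) (u k)) by continuity act.
apply: (bochner_bound mu compactG cuu) => k.
rewrite rnorm_cstar ler_pXn2r ?nnegrE// /u rnorm_star.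
by rewrite (le_trans (MP _ _))// ler_wpM2l ?fK.
Qed.

(* The operator norm of conv f on (C(G, A), norm2), sealed like norm2. *)
Lemma opnorm_spec : {p : (G -> A) -> R | forall f, continuous f ->
  [/\ 0 <= p f, forall x, continuous x -> norm2 (conv f x) <= p f * norm2 x &
      forall K, 0 <= K -> (forall x, continuous x -> norm2 (conv f x) <= K * norm2 x) ->
        p f <= K]}.
Proof.
pose S f : set R := [set K | 0 <= K /\
   forall x, continuous x -> norm2 (conv f x) <= K * norm2 x].
exists (fun f => inf (S f)) => f cf.
have lbS : lbound (S f) 0 by move=> K [].
have S0 : S f !=set0 by have [K K0 KP] := norm2_conv cf; exists K.
split.
- exact: lb_le_inf.
- move=> x cx; have := norm2_ge0 mu alpha x; rewrite le_eqVlt => /predU1P[x0|x0].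
    (* When [norm2 x = 0], division is impossible, but any admissible constant already forces the
       left side to vanish. *)
    have [K [K0 KP]] := S0; have := KP x cx; by rewrite -x0 !mulr0.
  rewrite -ler_pdivrMr//; apply: lb_le_inf => // K [K0 KP].
  by rewrite ler_pdivrMr//; exact: KP.
- move=> K K0 KP; apply: ge_inf; first by exists 0.
  by split.
Qed.

Definition opnorm : (G -> A) -> R := sval opnorm_spec.

Lemma opnorm_ge0 f : continuous f -> 0 <= opnorm f.
Proof. by move=> cf; have [] := svalP opnorm_spec f cf. Qed.

Lemma opnormP f x : continuous f -> continuous x -> norm2 (conv f x) <= opnorm f * norm2 x.
Proof. by move=> cf cx; have [_ h _] := svalP opnorm_spec f cf; exact: h. Qed.

Lemma opnorm_le f (K : R) : continuous f -> 0 <= K ->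
  (forall x, continuous x -> norm2 (conv f x) <= K * norm2 x) -> opnorm f <= K.
Proof. by move=> cf; have [_ _ h] := svalP opnorm_spec f cf; exact: h. Qed.

Lemma convDl f1 f2 x : continuous f1 -> continuous f2 -> continuous x ->
  conv (fun g => f1 g + f2 g) x = (fun g => conv f1 x g + conv f2 x g).
Proof.
move=> c1 c2 cx; apply/funext => g.
have e1 : continuous (fun h => cmul (f1 h) (alpha h (x (h^-1 * g)%g))) by continuity act.
have e2 : continuous (fun h => cmul (f2 h) (alpha h (x (h^-1 * g)%g))) by continuity act.
rewrite /convolution -(bochnerD mu compactG e1 e2).
by apply: eq_bochner => h; rewrite cmulDl.
Qed.

Lemma convZl (c : R[i]) f x : continuous f -> continuous x ->
  conv (fun g => c *: f g) x = (fun g => c *: conv f x g).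
Proof.
move=> cf cx; apply/funext => g.
have e1 : continuous (fun h => cmul (f h) (alpha h (x (h^-1 * g)%g))) by continuity act.
rewrite /convolution -(bochnerZ mu compactG c e1).
by apply: eq_bochner => h; rewrite cmulZl.
Qed.

Lemma opnormZ_le (c : R[i]) f : continuous f ->
  opnorm (fun g => c *: f g) <= rnorm (c : R[i]^o) * opnorm f.
Proof.
move=> cf; apply: opnorm_le => [||x cx]; first by continuity act.
  by rewrite mulr_ge0// opnorm_ge0.
rewrite convZl// (norm2Z mu compactG act); last exact: continuous_conv.
by rewrite -mulrA ler_wpM2l// opnormP.
Qed.

(** Moving [f] across the inner product by [ip_adjoint], Cauchy-Schwarz bounds the square of
    [norm2 (conv f x)] by [norm2] of the image of [x] under [conv (inv f) f], times [norm2 x]. *)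
Lemma opnorm_inv_le f : continuous f -> opnorm f ^+ 2 <= opnorm (conv (inv f) f).
Proof.
move=> cf; have cif := continuous_inv act cf.
have cff := continuous_conv (mu := mu) compactG act cif cf.
have p0 := opnorm_ge0 cff.
rewrite -[leRHS]sqr_sqrtr// ler_pXn2r ?nnegrE ?sqrtr_ge0 ?opnorm_ge0//.
apply: (opnorm_le cf (sqrtr_ge0 _)) => x cx.
have cfx := continuous_conv (mu := mu) compactG act cf cx.
have cffx := continuous_conv (mu := mu) compactG act cff cx.
apply: norm2_le; first by apply: mulr_ge0; [exact: sqrtr_ge0 | exact: norm2_ge0].
rewrite exprMn (sqr_sqrtr p0).
rewrite (ip_adjoint compactG haar act cf cfx cx).
rewrite (conv_assoc compactG haar act cif cf cx).
rewrite (le_trans (ip_le mu compactG act cffx cx))// expr2 mulrA ler_wpM2r ?norm2_ge0//.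
exact: opnormP.
Qed.

Lemma opnormM f1 f2 : continuous f1 -> continuous f2 ->
  opnorm (conv f1 f2) <= opnorm f1 * opnorm f2.
Proof.
move=> c1 c2; have c12 := continuous_conv (mu := mu) compactG act c1 c2.
have p1 := opnorm_ge0 c1; have p2 := opnorm_ge0 c2.
apply: (opnorm_le c12 (mulr_ge0 p1 p2)) => x cx.
have c2x := continuous_conv (mu := mu) compactG act c2 cx.
rewrite -(conv_assoc compactG haar act c1 c2 cx).
rewrite (le_trans (opnormP c1 c2x))// -mulrA ler_wpM2l//; exact: opnormP.
Qed.

Lemma opnorm_inv f : continuous f -> opnorm (inv f) = opnorm f.
Proof.
have le f' : continuous f' -> opnorm f' <= opnorm (inv f').
  move=> cf; have cif := continuous_inv act cf.
  have := opnorm_ge0 cf; rewrite le_eqVlt => /predU1P[<-|f0]; first exact: opnorm_ge0.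
  rewrite -(ler_pM2r f0) -expr2 (le_trans (opnorm_inv_le cf))//.
  exact: opnormM.
move=> cf; have cif := continuous_inv act cf.
apply/eqP; rewrite eq_le (le f cf) andbT.
by have := le _ cif; rewrite (invfK act).
Qed.

Lemma cstar_seminorm_opnorm : cstar_seminorm mu alpha (fun f => (opnorm f)%:C).
Proof.
split.
- by move=> f cf; rewrite lecR opnorm_ge0.
- move=> f1 f2 c1 c2; rewrite -rmorphD lecR.
  have p1 := opnorm_ge0 c1; have p2 := opnorm_ge0 c2.
  apply: opnorm_le => [||x cx]; [by continuity act | exact: addr_ge0 |].
  have e1 := continuous_conv (mu := mu) compactG act c1 cx.
  have e2 := continuous_conv (mu := mu) compactG act c2 cx.
  rewrite convDl// (le_trans (norm2D mu compactG act e1 e2))// mulrDl.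
  by apply: lerD; exact: opnormP.
- move=> c f cf; have -> : `|c| = (rnorm (c : R[i]^o))%:C by exact: (rnormE (c : R[i]^o)).
  rewrite -rmorphM; congr (_%:C).
  apply/eqP; rewrite eq_le opnormZ_le//=.
  (* For [c] nonzero the reverse inequality is [opnormZ_le] applied to [c^-1] and the scaled
     function. *)
  have [->|c0] := eqVneq c 0.
    rewrite rnorm0 mul0r opnorm_ge0//; by continuity act.
  have c0' : 0 < rnorm (c : R[i]^o) by rewrite rnorm_gt0.
  have ccf : continuous (fun g => c *: f g) by continuity act.
  rewrite -ler_pdivlMl//; have := opnormZ_le c^-1 ccf.
  have -> : (fun g => c^-1 *: (c *: f g)) = f.
    by apply/funext => g; rewrite scalerA mulVf// scale1r.
  suff -> : rnorm (c^-1 : R[i]^o) = (rnorm (c : R[i]^o))^-1 by [].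
  apply: (mulfI (lt0r_neq0 c0')); rewrite -rnormM (divff c0).
  rewrite (divff (lt0r_neq0 c0')); exact: (etrans (rnorm_real 1) (normr1 _)).
- by move=> f1 f2 c1 c2; rewrite -rmorphM lecR opnormM.
- move=> f cf; rewrite -rmorphXn; congr (_%:C).
  apply/eqP; rewrite eq_le opnorm_inv_le// andbT.
  have cif := continuous_inv act cf.
  by rewrite (le_trans (opnormM cif cf))// opnorm_inv// expr2.
Qed.

End RegularNorm.

(** * Density *)

Section Averages.
Variables (R : realType) (G : topologicalGroupType).
Variable mu : probability (borel G) R.
Hypothesis compactG : compact [set: G].
Hypothesis hausdorffG : hausdorff_space G.
Hypothesis haar : normalized_haar mu.
Local Notation I f := (bochner_integral mu f).

Lemma continuous_real_scalars (X : topologicalType) (f : X -> R) : continuous f ->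
  continuous (fun h => (f h)%:C : scalars R).
Proof.
move=> cf x; apply/cvg_rnormP => e e0; move/cvgrPdist_lt : (cf x) => /(_ _ e0).
apply: filterS => y; rewrite distrC => fe.
by rewrite -rmorphB (le_lt_trans _ fe)//; rewrite (rnorm_real (f y - f x)).
Qed.

Lemma bump_function (U : set G) : nbhs 1%g U -> exists f : G -> R,
  [/\ continuous f, forall h, 0 <= f h, f 1%g = 1 & forall h, ~ U h -> f h = 0].
Proof.
move=> nU; have nG := compact_normal hausdorffG compactG.
have sep : uniform_separator [set (1 : G)%g] (~` U^°).
  apply: (@normal_completely_regular R _ nG (hausdorff_accessible hausdorffG)).
    by apply: open_closedC; exact: open_interior.
  by apply; exact: nU.
move/(@uniform_separatorP G R) : sep => [f [cf f01 f0 f1]].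
exists (fun h => 1 - f h); split.
- by move=> h; apply: cvgB; [exact: cvg_cst | exact: cf].
- move=> h; rewrite subr_ge0.
  by have := f01 (f h); rewrite /= in_itv/= => /(_ _)/andP[]//; exists h.
- by rewrite (f0 (f 1%g)) ?subr0//; exists 1%g.
- move=> h nUh; rewrite (f1 (f h)) ?subrr//; exists h => //=.
  by move=> /interior_subset.
Qed.

(** Finitely many left translates of the set where [f > 1/2] cover [G]. The sum of the corresponding
    translates of [f] is at least 1/2 everywhere, while each has the same integral [c]. *)
Lemma bump_integral_gt0 (f : G -> R) : continuous f -> (forall h, 0 <= f h) -> f 1%g = 1 ->
  0 < complex.Re (I (fun h => (f h)%:C : scalars R)).
Proof.
move=> cf f0 f1; have cfC := continuous_real_scalars cf.
set c := complex.Re _.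
pose V g := [set h : G | 1 / 2 < f (g^-1 * h)%g].
have nV g : nbhs g (V g).
  have cg : continuous (fun h => f (g^-1 * h)%g).
    move=> h; apply: (@continuous_comp _ _ _ (fun h => (g^-1 * h)%g) f); last exact: cf.
    exact: (continuous_mulg (@continuous_const _ _ _) (@continuous_idfun _)).
  have half0 : 0 < 1 / 2 :> R by rewrite divr_gt0.
  have /cvgrPdist_lt/(_ _ half0) := cg g; apply: filterS => h /=.
  rewrite mulVg f1.
  by rewrite ltr_norml => /andP[_]; rewrite /V /=; lra.
have [T [idx [pt [midx Vpt]]]] := fine_partition compactG nV.
pose ft t h := f ((pt t)^-1 * h)%g.
have cft t : continuous (fun h => (ft t h)%:C : scalars R).
  apply: continuous_real_scalars => h.
  apply: (@continuous_comp _ _ _ (fun h => ((pt t)^-1 * h)%g) f); last exact: cf.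
  exact: (continuous_mulg (@continuous_const _ _ _) (@continuous_idfun _)).
pose k h := \sum_t ft t h.
have [ck Ik] := @bochner_sum R G mu compactG (scalars R) T (index_enum T)
   (fun=> 1) (fun t h => (ft t h)%:C) cft.
have kE : (fun h => (k h)%:C : scalars R) =
    (fun h => \sum_t 1 *: ((ft t h)%:C : scalars R)).
  apply/funext => h; rewrite /k rmorph_sum; apply: eq_bigr => t _.
  by rewrite scale1r.
have half : continuous (fun _ : G => (1 / 2)%:C : scalars R) by exact: continuous_const.
have := @bochner_dominated R G mu compactG (scalars R) (fun=> (1 / 2)%:C) k half.
rewrite kE Ik (bochner_cst mu compactG) => /(_ ck).
have -> : \sum_t 1 *: I (fun h => (ft t h)%:C : scalars R) = (c *+ #|T|)%:C.
  rewrite rmorphMn -sumr_const; apply: eq_bigr => t _; rewrite scale1r.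
  rewrite -[RHS](bochner_real mu compactG cfC).
  exact: (bochner_translate compactG haar (pt t)^-1%g cfC).
rewrite (rnorm_real (1 / 2)) gtr0_norm ?divr_gt0// => H.
have {}H : 1 / 2 <= c *+ #|T|.
  apply: H => h; rewrite /k (bigD1 (idx h))//= (le_trans (ltW (Vpt h)))// lerDl.
  by apply: sumr_ge0 => t _; exact: f0.
rewrite ltNge; apply/negP => c0; have := mulrn_wle0 #|T| c0; lra.
Qed.

Lemma normalized_bump (U : set G) : nbhs 1%g U -> exists w : G -> R,
  [/\ continuous w, forall h, 0 <= w h, forall h, ~ U h -> w h = 0 &
      I (fun h => (w h)%:C : scalars R) = 1].
Proof.
move=> /bump_function[f [cf f0 f1 fU]]; have := bump_integral_gt0 cf f0 f1.
have cfC := continuous_real_scalars cf.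
set c := complex.Re _ => c0; exists (fun h => c^-1 * f h); split.
- by move=> h; apply: cvgM; [exact: cvg_cst | exact: cf].
- by move=> h; rewrite mulr_ge0// invr_ge0 ltW.
- by move=> h /fU ->; rewrite mulr0.
- transitivity (c^-1%:C *: I (fun h => (f h)%:C : scalars R)).
    rewrite -(bochnerZ mu compactG _ cfC); apply: eq_bochner => h.
    exact: rmorphM.
  rewrite (bochner_real mu compactG cfC) -/c.
  rewrite -[LHS]/((c^-1%:C * c%:C) : R[i]) -rmorphM mulVf ?gt_eqF//.
Qed.

(** The weight [w] is a probability density carried by [U]: the constant [y0] is its own average and
    only the deviation on [U] contributes. *)
Lemma average_near (V : completeNormedModType R[i]) (w : G -> R) (U : set G)
    (y : G -> V) (y0 : V) (e : R) :
  continuous w -> (forall h, 0 <= w h) -> (forall h, ~ U h -> w h = 0) ->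
  I (fun h => (w h)%:C : scalars R) = 1 -> continuous y ->
  (forall h, U h -> rnorm (y h - y0) <= e) ->
  rnorm (I (fun h => (w h)%:C *: y h) - y0) <= e.
Proof.
move=> cw w0 wU Iw cy yU; have cwC := continuous_real_scalars cw.
have cwy (z : G -> V) : continuous z -> continuous (fun h => (w h)%:C *: z h).
  by move=> cz h; apply: cvgZ; [exact: cwC | exact: cz].
have cy0 : continuous (fun _ : G => y0) by exact: continuous_const.
have Iy0 : I (fun h => (w h)%:C *: y0) = y0.
  transitivity ((I (fun h => (w h)%:C : scalars R) : R[i]) *: y0); last by rewrite Iw scale1r.
  apply: (@bochner_map R G mu compactG (scalars R) V (fun z => (z : R[i]) *: y0) (rnorm y0)) => //.
  - by move=> a b; exact: scalerDl.
  - by move=> r a; rewrite scalerA.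
  - by move=> a; rewrite rnormZ mulrC.
rewrite -{1}Iy0 -(bochnerB mu compactG (cwy _ cy) (cwy _ cy0)).
have cd : continuous (fun h => (w h)%:C *: y h - (w h)%:C *: y0).
  by move=> h; apply: cvgB; [exact: cwy | exact: cwy].
have ck : continuous (fun h => (w h * e)%:C : scalars R).
  by apply: continuous_real_scalars => h; apply: cvgM; [exact: cw | exact: cvg_cst].
have := bochner_dominated mu compactG cd ck.
have -> : I (fun h => (w h * e)%:C : scalars R) = e%:C.
  transitivity (e%:C *: I (fun h => (w h)%:C : scalars R)).
    rewrite -(bochnerZ mu compactG _ cwC); apply: eq_bochner => h.
    by rewrite mulrC; exact: rmorphM.
  by rewrite Iw; exact: mulr1.
apply => h; rewrite -scalerBr rnormZr (ger0_norm (w0 h)).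
have [Uh|/wU ->] := pselect (U h); last by rewrite !mul0r.
by rewrite ler_wpM2l// yU.
Qed.

End Averages.

(** * Approximation by convolutions and stability of the span *)

Section Approximation.
Variables (R : realType) (G : topologicalGroupType) (A : cstarAlgType R).
Variables (mu : probability (borel G) R) (alpha : G -> A -> A).
Hypothesis compactG : compact [set: G].
Hypothesis hausdorffG : hausdorff_space G.
Hypothesis haar : normalized_haar mu.
Hypothesis act : continuous_action alpha.
Local Notation I f := (bochner_integral mu f).
Local Notation conv := (convolution mu alpha).
Local Notation norm2 := (norm2 mu alpha).
Implicit Types (f x y F : G -> A) (a b : A).

(** An approximate unit for finitely many sample values serves the whole range, as [a - u a] and
    [a - a u] never exceed [a] in norm. The same fact gives the factor 2. *)
Lemma approximate_unit_range f (e : R) : continuous f -> 0 < e -> exists u : A,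
  [/\ forall a, rnorm (cmul u a) <= 2 * rnorm a,
      forall g, rnorm (f g - cmul u (f g)) <= e &
      forall g, rnorm (f g - cmul (f g) u) <= e].
Proof.
move=> cf e0; have e20 : 0 < e / 2 by rewrite divr_gt0.
have [T [idx [pt [midx fe]]]] := oscillation_partition compactG e20 cf.
have [u [su ru lu rs ls]] := approximate_unit [seq f (pt t) | t <- index_enum T] e20.
have mem t : f (pt t) \in [seq f (pt t) | t <- index_enum T].
  by apply: map_f; exact: mem_index_enum.
have split4 (q p s r : A) : q - s = q - p - (s - r) + (p - r).
  by rewrite addrAC addrA subrK opprB addrA subrK.
exists u; split.
- move=> a; have := rnormB a (a - cmul u a); rewrite opprB addrC subrK.
  by move/le_trans; apply; rewrite mulr_natl mulr2n lerD2l.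
- move=> g; rewrite (split4 _ (f (pt (idx g))) _ (cmul u (f (pt (idx g))))) -cmulBr.
  rewrite (le_trans (rnormD _ _))// [leRHS]splitr.
  by apply: lerD; [exact: le_trans (lu _) (fe g) | exact: ls].
- move=> g; rewrite (split4 _ (f (pt (idx g))) _ (cmul (f (pt (idx g))) u)) -cmulBl.
  rewrite (le_trans (rnormD _ _))// [leRHS]splitr.
  by apply: lerD; [exact: le_trans (ru _) (fe g) | exact: rs].
Qed.

Lemma conv_approx_left f (e : R) : continuous f -> 0 < e ->
  exists x, continuous x /\ forall g, rnorm (conv x f g - f g) <= e.
Proof.
move=> cf e0; have e20 : 0 < e / 2 by rewrite divr_gt0.
(* Multiplication by [u] may double the oscillation, so a quarter is allotted to obtain [e / 2]. *)
have e40 : 0 < e / 4 by rewrite divr_gt0.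
have [u [u2 uf _]] := approximate_unit_range cf e20.
pose H h g := alpha h (f (h^-1 * g)%g).
have cH : continuous (fun x : G * G => H x.1 x.2) by rewrite /H; continuity act.
have [w [cw w0 wU Iw]] := normalized_bump compactG hausdorffG haar (tube compactG 1%g e40 cH).
have cwC := continuous_real_scalars cw.
exists (fun h => (w h)%:C *: u); split=> [|g].
  by move=> h; apply: cvgZ; [exact: cwC | exact: cvg_cst].
have cHg : continuous (fun h => cmul u (H h g)) by rewrite /H; continuity act.
have -> : conv (fun h => (w h)%:C *: u) f g = I (fun h => (w h)%:C *: cmul u (H h g)).
  by apply: eq_bochner => h; rewrite cmulZl.
rewrite (le_trans (rdistD (cmul u (f g)) _ _))// [leRHS]splitr lerD//; last first.
  by rewrite rdistC.
apply: (average_near compactG cw w0 wU Iw cHg) => h Uh.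
rewrite -cmulBr (le_trans (u2 _))//; have := Uh g.
by rewrite /H invg1 mul1g (action1 act) => /ltW; lra.
Qed.

Lemma conv_approx_right f (e : R) : continuous f -> 0 < e ->
  exists x, continuous x /\ forall g, rnorm (conv f x g - f g) <= e.
Proof.
move=> cf e0; have e20 : 0 < e / 2 by rewrite divr_gt0.
have [M M0 MP] := action_bounded act.
have eM0 : 0 < e / 2 / M by rewrite divr_gt0.
(* On the right the unit appears as [alpha g u], so it has to absorb the values pulled back by
   [alpha g^-1]. *)
pose E g := alpha g^-1%g (f g).
have cE : continuous E by rewrite /E; continuity act.
have [u [_ _ uE]] := approximate_unit_range cE eM0.
pose H h g := cmul (f (g * h)%g) (alpha (g * h)%g u).
have cH : continuous (fun x : G * G => H x.1 x.2) by rewrite /H; continuity act.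
have [w [cw w0 wU Iw]] := normalized_bump compactG hausdorffG haar (tube compactG 1%g e20 cH).
have cwC := continuous_real_scalars cw.
have cwV : continuous (fun h => (w h^-1%g)%:C *: u).
  move=> h; apply: cvgZ; last exact: cvg_cst.
  apply: (@continuous_comp _ _ _ (fun h => h^-1%g) (fun h => (w h)%:C : scalars R)).
    exact: invg_continuous.
  exact: cwC.
(* w is evaluated at the inverse, so that no invariance of mu under inversion
   is needed. *)
exists (fun h => (w h^-1%g)%:C *: u); split=> [//|g].
have cHg : continuous (fun h => H h g) by rewrite /H; continuity act.
have -> : conv f (fun h => (w h^-1%g)%:C *: u) g = I (fun h => (w h)%:C *: H h g).
  have cc : continuous (fun h => cmul (f h) (alpha h ((w (h^-1 * g)^-1%g)%:C *: u))).
    pose wu h := (w h^-1%g)%:C *: u.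
    by change (continuous (fun h => cmul (f h) (alpha h (wu (h^-1 * g)%g)))); continuity act.
  rewrite /convolution -(bochner_translate compactG haar g cc); apply: eq_bochner => h.
  by rewrite [(_ * g)^-1%g]invgM invgK mulKg (actionZ act) cmulZr.
rewrite (le_trans (rdistD (cmul (f g) (alpha g u)) _ _))// [leRHS]splitr lerD//; last first.
  have -> : cmul (f g) (alpha g u) - f g = alpha g (cmul (E g) u - E g).
    by rewrite (alphaB act) (action_cmul act) /E !(alphaK act).
  by rewrite (le_trans (MP _ _))// -ler_pdivlMl// mulrC rdistC.
apply: (average_near compactG cw w0 wU Iw cHg) => h Uh.
by have := Uh g; rewrite /H mulg1 => /ltW.
Qed.

Lemma norm2_sup : exists2 M : R, 0 <= M & forall x (s : R), continuous x -> 0 <= s ->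
  (forall g, rnorm (x g) <= s) -> norm2 x <= M * s.
Proof.
have [M M0 MP] := action_bounded act; exists M; first exact: ltW.
move=> x s cx s0 xs; have ctx := continuous_twist act cx.
have Ms0 : 0 <= M * s by rewrite mulr_ge0// ltW.
apply: norm2_le => //.
have cxx : continuous (fun h => cmul (star (twist alpha x h)) (twist alpha x h)).
  by continuity act.
apply: (bochner_bound mu compactG cxx) => h; rewrite rnorm_cstar.
by rewrite ler_pXn2r ?nnegrE// (le_trans (MP _ _))// ler_wpM2l ?(ltW M0).
Qed.

Lemma convBl f1 f2 x g : continuous f1 -> continuous f2 -> continuous x ->
  conv (fun g => f1 g - f2 g) x g = conv f1 x g - conv f2 x g.
Proof.
move=> c1 c2 cx.
have e1 : continuous (fun h => cmul (f1 h) (alpha h (x (h^-1 * g)%g))) by continuity act.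
have e2 : continuous (fun h => cmul (f2 h) (alpha h (x (h^-1 * g)%g))) by continuity act.
rewrite /convolution -(bochnerB mu compactG e1 e2).
by apply: eq_bochner => h; rewrite cmulBl.
Qed.

Lemma convBr f x1 x2 g : continuous f -> continuous x1 -> continuous x2 ->
  conv f (fun g => x1 g - x2 g) g = conv f x1 g - conv f x2 g.
Proof.
move=> cf c1 c2.
have e1 : continuous (fun h => cmul (f h) (alpha h (x1 (h^-1 * g)%g))) by continuity act.
have e2 : continuous (fun h => cmul (f h) (alpha h (x2 (h^-1 * g)%g))) by continuity act.
rewrite /convolution -(bochnerB mu compactG e1 e2).
by apply: eq_bochner => h; rewrite (alphaB act) cmulBr.
Qed.

Lemma cmul_sumr (J : Type) (s : seq J) (k : J -> A) a :
  cmul a (\sum_(j <- s) k j) = \sum_(j <- s) cmul a (k j).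
Proof. exact: (big_morph (cmul a) (cmulDr a) (cmul0r a)). Qed.

Lemma cmul_suml (J : Type) (s : seq J) (k : J -> A) a :
  cmul (\sum_(j <- s) k j) a = \sum_(j <- s) cmul (k j) a.
Proof. exact: (big_morph (fun b => cmul b a) (fun b c => cmulDl b c a) (cmul0l a)). Qed.

Lemma alpha_sum (J : Type) (s : seq J) (k : J -> A) g :
  alpha g (\sum_(j <- s) k j) = \sum_(j <- s) alpha g (k j).
Proof. exact: (big_morph (alpha g) (actionD act g) (alpha0 act g)). Qed.

Lemma Fin_continuous f : Fin alpha f -> continuous f.
Proof.
move=> [n [c [a [b ->]]]].
have cb i : continuous (fun g => cmul (a i) (alpha g (star (b i)))) by continuity act.
exact: (bochner_sum mu compactG (index_enum 'I_n) c cb).1.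
Qed.

(** Since [alpha h] composed with [alpha (h^-1 * g)] is [alpha g], the factor depending on [g]
    leaves the integral, and only the coefficients [a i] change. *)
Lemma Fin_conv_left f x : continuous x -> Fin alpha f -> Fin alpha (conv x f).
Proof.
move=> cx [n [c [a [b ->]]]].
exists n, c, (fun i => I (fun h => cmul (x h) (alpha h (a i)))), b.
apply/funext => g.
pose k i h := cmul (cmul (x h) (alpha h (a i))) (alpha g (star (b i))).
have ck i : continuous (k i) by rewrite /k; continuity act.
transitivity (I (fun h => \sum_(i < n) c i *: k i h)).
  apply: eq_bochner => h; rewrite alpha_sum cmul_sumr; apply: eq_bigr => i _.
  rewrite (actionZ act) cmulZr (action_cmul act) cmulA.
  by rewrite -(actionM act) mulgA mulgV mul1g.
rewrite (bochner_sum mu compactG _ c ck).2; apply: eq_bigr => i _.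
by rewrite (bochner_cmulr mu compactG)//; continuity act.
Qed.

(** After left translation by [g], the map [alpha g] leaves the integral. The remainder [v i] is
    stored as [star (v i)] because generators of the span contain an adjoint. *)
Lemma Fin_conv_right f x : continuous x -> Fin alpha f -> Fin alpha (conv f x).
Proof.
move=> cx [n [c [a [b ->]]]].
pose v i := I (fun h => alpha h (cmul (star (b i)) (x h^-1%g))).
exists n, c, a, (fun i => star (v i)); apply/funext => g.
pose k i h := cmul (a i) (alpha h (cmul (star (b i)) (x (h^-1 * g)%g))).
have ck i : continuous (k i) by rewrite /k; continuity act.
transitivity (I (fun h => \sum_(i < n) c i *: k i h)).
  apply: eq_bochner => h; rewrite cmul_suml; apply: eq_bigr => i _.
  by rewrite /k cmulZl -cmulA (action_cmul act).
rewrite (bochner_sum mu compactG _ c ck).2; apply: eq_bigr => i _; congr (_ *: _).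
have cv : continuous (fun h => alpha h (cmul (star (b i)) (x h^-1%g))) by continuity act.
rewrite -(bochner_translate compactG haar g (ck i)) starK /v.
rewrite -(bochner_alpha mu compactG act g cv).
rewrite -(bochner_cmull mu compactG); last by continuity act.
apply: eq_bochner => h.
by rewrite /k invgM mulgVK (actionM act).
Qed.

End Approximation.

Theorem proposition9p8 (R : realType) (G : topologicalGroupType)
    (A : cstarAlgType R) (alpha : G -> A -> A)
    (mu : probability (borel G) R)
    (B : cstarAlgType R) (iota : (G -> A) -> B) :
  compact [set: G] ->
  lie_group R G ->
  continuous_action alpha ->
  normalized_haar mu ->
  crossed_product mu alpha iota ->
  saturated alpha iota ->
  principal alpha.
Proof.
move=> compactG [hausdorffG _ _] act haar crossed sat F cF P /uniform_nbhs[E [entE EP]].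
have [r /= /gt0_complexE[rE r0] rP] : exists2 r : R[i], 0 < r &
    [set xy | ball xy.1 r xy.2] `<=` E.
  by move: entE; rewrite -entourage_ballE => -[r r0 rP]; exists r.
move: (complex.Re r) r0 rE => e e0 rE; have e30 : 0 < e / 3 by rewrite divr_gt0.
have e60 : 0 < e / 6 by rewrite divr_gt0.
have [x [cx xF]] := conv_approx_left compactG hausdorffG haar act cF e60.
have [K K0 xK] := conv_sup compactG haar act cx.
have [M M0 MP] := norm2_sup mu compactG act.
have KM0 : 0 <= K * M by exact: mulr_ge0.
have KM1 : 0 < K * M + 1 by rewrite ltr_wpDl.
(* A uniform error in [F * y] is multiplied by [M] on passing to [norm2] and by [K] on convolving
   with [x]; adding 1 avoids a zero denominator. *)
have d0 : 0 < e / 3 / (K * M + 1) by rewrite divr_gt0.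
have [y [cy Fy]] := conv_approx_right compactG hausdorffG haar act cF d0.
have y0 : 0 <= norm2 mu alpha y by exact: norm2_ge0.
have Ky0 : 0 < K * norm2 mu alpha y + 1 by rewrite ltr_wpDl// mulr_ge0.
(* The tolerance in the crossed product is paid by [K] and [norm2 y], which is why [y] precedes
   [f]. *)
pose d := e / 3 / (K * norm2 mu alpha y + 1); have dpos : 0 < d by rewrite divr_gt0.
have [f Ff Ffd] : exists2 f, Fin alpha f & rnorm (iota F - iota f) < d.
  have dC : 0 < d%:C :> R[i] by rewrite ltcR.
  have [||b [/interior_subset Bb [f Ff fb]]] := sat (ball (iota F) d%:C)^°.
  - by exists (iota F); apply: nbhsx_ballx.
  - exact: open_interior.
  exists f => //; move: Bb; rewrite -fb -ball_normE /=.
  by rewrite rnormE ltcR.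
have cf := Fin_continuous mu compactG act Ff.
have cFf : continuous (fun g => F g - f g) by exact: (continuous_subr cF cf).
(* Maximality of the crossed product norm, applied to the seminorm [opnorm], transfers the
   approximation to the regular representation. *)
have opFf : opnorm compactG haar act (fun g => F g - f g) <= d.
  have sm := cstar_seminorm_opnorm compactG haar act.
  have := crossed_max crossed sm cFf; rewrite rnormE lecR => /le_trans; apply.
  suff -> : iota (fun g => F g - f g) = iota F - iota f by exact: ltW.
  have cNf : continuous (fun g => -1 *: f g) by exact: continuous_scaler.
  rewrite -scaleN1r -(crossedZ crossed _ cf) -(crossedD crossed cF cNf).
  by congr iota; apply/funext => g; rewrite scaleN1r.
have cFy := continuous_conv (mu := mu) compactG act cF cy.
have cfy := continuous_conv (mu := mu) compactG act cf cy.
exists (convolution mu alpha x (convolution mu alpha f y)); split.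
  exact: (Fin_conv_left mu compactG act cx (Fin_conv_right compactG haar act cy Ff)).
apply: EP => g _; apply: rP; rewrite /= -ball_normE /= rnormE rE ltcR.
have h1 : rnorm (F g - convolution mu alpha x F g) <= e / 6 by rewrite rdistC.
have h2 : rnorm (convolution mu alpha x F g -
    convolution mu alpha x (convolution mu alpha F y) g) <= e / 3.
  rewrite rdistC -(convBr mu compactG act _ cx cFy cF).
  have cD : continuous (fun g => convolution mu alpha F y g - F g).
    exact: (continuous_subr cFy cF).
  rewrite (le_trans (xK _ g cD))// (le_trans (ler_wpM2l K0 (MP _ _ cD (ltW d0) Fy)))//.
  have -> : K * (M * (e / 3 / (K * M + 1))) = e / 3 * (K * M) / (K * M + 1) by ring.
  by rewrite ler_pdivrMr// ler_wpM2l ?(ltW e30)// lerDl.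
have h3 : rnorm (convolution mu alpha x (convolution mu alpha F y) g -
    convolution mu alpha x (convolution mu alpha f y) g) <= e / 3.
  rewrite -(convBr mu compactG act _ cx cFy cfy).
  have -> : (fun g => convolution mu alpha F y g - convolution mu alpha f y g) =
      convolution mu alpha (fun g => F g - f g) y.
    by apply/funext => g'; rewrite (convBl mu compactG act _ cF cf cy).
  have cD := continuous_conv (mu := mu) compactG act cFf cy.
  rewrite (le_trans (xK _ g cD))//.
  rewrite (le_trans (ler_wpM2l K0 (opnormP compactG haar act cFf cy)))//.
  rewrite mulrCA (le_trans (ler_wpM2r _ opFf)) ?mulr_ge0//.
  by rewrite /d mulrAC ler_pdivrMr// ler_wpM2l ?(ltW e30)// lerDl.
have h4 := rdistD (convolution mu alpha x F g) (F g)
  (convolution mu alpha x (convolution mu alpha f y) g).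
have h5 := rdistD (convolution mu alpha x (convolution mu alpha F y) g)
  (convolution mu alpha x F g) (convolution mu alpha x (convolution mu alpha f y) g).
(* The errors add up to [e/6 + e/3 + e/3], which leaves room for the strict inequality. *)
apply: le_lt_trans (le_trans h4 (lerD h1 (le_trans h5 (lerD h2 h3)))) _.
by clear -e0; lra.
Qed.
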